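(* Let $\mathcal{X}^+$ be the nonsymmetric operad over $\mathbb{Q}$ generated by four binary operations $x,y,z,t$ subject to the sixteen quadratic relations listed in the context (with the sign $+$ in relation (16)), and let $\mathcal{X}^+_n$ denote its component of arity $n$. Then for all integers $n\ge 5$, $$\dim_{\mathbb{Q}}\mathcal{X}^+_n=\binom{2n}{n-1}+1.$$
   Context: Let $k$ be a field (in the claim, $k=\mathbb{Q}$). The free nonsymmetric operad $\mathcal{T}$ over $k$ on four binary operations $x,y,z,t$ has as its arity $n$ component $\mathcal{T}_n$ ($n\ge 1$) the $k$-vector space with basis all planar rooted binary trees with $n$ leaves whose $n-1$ internal vertices are labelled by elements of $\{x,y,z,t\}$. Equivalently, the basis consists of all fully parenthesized monomials in the operations $x,y,z,t$ in which the arguments $a_1,\dots,a_n$ occur exactly once each, in this order; for $n=1$ the only basis element is the identity operation. Operadic composition is grafting of trees. There is no action of symmetric groups. For a choice of sign $\pm$, the operad $\mathcal{X}^{\pm}$ over $k$ is the quotient of $\mathcal{T}$ by the operadic ideal generated by the following sixteen relations of arity three (each relation ''$L=R$'' means that $L-R$ is a generator of the ideal): (1) $x(x(a_1,a_2),a_3)=x(a_1,x(a_2,a_3))+x(a_1,t(a_2,a_3))$, (2) $x(x(a_1,a_2),a_3)=x(a_1,y(a_2,a_3))+x(a_1,z(a_2,a_3))$, (3) $x(z(a_1,a_2),a_3)=z(a_1,x(a_2,a_3))+z(a_1,t(a_2,a_3))$, (4) $z(x(a_1,a_2),a_3)=z(a_1,z(a_2,a_3))+z(a_1,y(a_2,a_3))$,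 (5) $z(z(a_1,a_2),a_3)=z(a_1,z(a_2,a_3))+z(a_1,y(a_2,a_3))$, (6) $x(t(a_1,a_2),a_3)=t(a_1,x(a_2,a_3))$, (7) $x(t(a_1,a_2),a_3)=t(a_1,z(a_2,a_3))$, (8) $x(y(a_1,a_2),a_3)=y(a_1,x(a_2,a_3))$, (9) $z(t(a_1,a_2),a_3)=y(a_1,z(a_2,a_3))$, (10) $z(y(a_1,a_2),a_3)=y(a_1,z(a_2,a_3))$, (11) $t(x(a_1,a_2),a_3)+t(t(a_1,a_2),a_3)=t(a_1,t(a_2,a_3))$, (12) $t(x(a_1,a_2),a_3)+t(t(a_1,a_2),a_3)=t(a_1,y(a_2,a_3))$, (13) $t(z(a_1,a_2),a_3)+t(y(a_1,a_2),a_3)=y(a_1,t(a_2,a_3))$, (14) $y(x(a_1,a_2),a_3)+y(t(a_1,a_2),a_3)=y(a_1,y(a_2,a_3))$, (15) $y(z(a_1,a_2),a_3)+y(y(a_1,a_2),a_3)=y(a_1,y(a_2,a_3))$, (16) $y(z(a_1,a_2),a_3)-y(x(a_1,a_2),a_3)=\pm\bigl(x(a_1,t(a_2,a_3))-x(a_1,y(a_2,a_3))\bigr)$. The operad $\mathcal{X}^+$ is obtained with the sign $+$ in (16), and $\mathcal{X}^-$ with the sign $-$ in (16). The arity $n$ component of the quotient is denoted $\mathcal{X}^{\pm}_n$. *)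

(* Defs.v *)
From HB Require Import structures.
From mathcomp Require Import all_boot all_order all_algebra.
From mathcomp Require Import generic_quotient ring_quotient boolp.

Set Implicit Arguments.
Unset Strict Implicit.
Unset Printing Implicit Defensive.

Import GRing.Theory.
Local Open Scope ring_scope.
Local Open Scope quotient_scope.

(* The quotient of a finite-dimensional space V by a subspace U, as a
   finite-dimensional space. *)
Section QuotientSpace.
Variables (K : fieldType) (V : vectType K) (U : {vspace V}).

Definition quotv : Type := Quotient.quot (pred_of_vspace U).
HB.instance Definition _ := ZmodQuotient.on quotv.

Definition quotv_scale (a : K) (u : quotv) : quotv := \pi_quotv (a *: repr u).

Lemma eq_quotv (v w : V) : (\pi_quotv v == \pi_quotv w) = (v - w \in U).
Proof. by rewrite [RHS]Quotient.idealrBE. Qed.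

Lemma quotv_scale_pi a v : quotv_scale a (\pi_quotv v) = \pi_quotv (a *: v).
Proof.
by apply/eqP; rewrite eq_quotv -scalerBr memvZ // -eq_quotv reprK.
Qed.

Fact quotv_scaleA a b u :
  quotv_scale a (quotv_scale b u) = quotv_scale (a * b) u.
Proof. by rewrite [quotv_scale b u]/quotv_scale quotv_scale_pi scalerA. Qed.

Fact quotv_scale1 : left_id 1 quotv_scale.
Proof. by move=> u; rewrite /quotv_scale scale1r reprK. Qed.

Fact quotv_scaleDr : right_distributive quotv_scale +%R.
Proof.
move=> a u w; rewrite -[u in LHS]reprK -[w in LHS]reprK -raddfD.
by rewrite quotv_scale_pi scalerDr raddfD.
Qed.

Fact quotv_scaleDl u : {morph quotv_scale^~ u : a b / a + b}.
Proof. by move=> a b; rewrite /quotv_scale scalerDl raddfD. Qed.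

HB.instance Definition _ := GRing.Zmodule_isLmodule.Build K quotv
  quotv_scaleA quotv_scale1 quotv_scaleDr quotv_scaleDl.

(* Coordinates on V / U are those of the complement U^C. *)
Let pi := daddv_pi U^C U.
Let coords (u : quotv) : 'rV[K]_(\dim U^C) :=
  \row_i coord (vbasis U^C) i (pi (repr u)).

Let piU v : v - pi v \in U.
Proof.
have UC0 : (U^C :&: U = 0)%VS by rewrite capvC capv_compl.
have defv : pi v + daddv_pi U U^C v = v.
  by apply: daddv_pi_add => //; rewrite addvC addv_complf memvf.
by rewrite -[X in X - _]defv addrC addKr memv_pi.
Qed.

Let pi_eq0 v : v \in U -> pi v = 0.
Proof.
move=> vU; apply/eqP; rewrite -memv0 -(capv_compl U) memv_cap memv_pi andbT.
by rewrite -[pi v](subKr v) rpredB.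
Qed.

Let pi_quot v : pi (repr (\pi_quotv v)) = pi v.
Proof.
have : pi (repr (\pi_quotv v) - v) = 0 by rewrite pi_eq0 // -eq_quotv reprK.
by rewrite raddfB => /subr0_eq.
Qed.

Fact quotv_vect_iso : Vector.axiom (\dim U^C) quotv.
Proof.
exists coords => [a u w|].
  rewrite -[u in LHS]reprK -[w in LHS]reprK.
  rewrite -[a *: _]/(quotv_scale _ _) quotv_scale_pi -raddfD.
  by apply/rowP => i; rewrite !mxE pi_quot !linearP.
exists (fun r : 'rV_(\dim U^C) => \pi_quotv (\sum_i r 0 i *: (vbasis U^C)`_i)).
  move=> u /=; rewrite -[RHS]reprK; apply/eqP; rewrite eq_sym eq_quotv.
  have -> : \sum_i coords u 0 i *: (vbasis U^C)`_i = pi (repr u).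
    rewrite [RHS](coord_vbasis (memv_pi _ _ _)).
    by apply: eq_bigr => i _; rewrite mxE.
  exact: piU.
move=> r; apply/rowP => i; rewrite mxE pi_quot /pi daddv_pi_id.
- by rewrite coord_sum_free ?(basis_free (vbasisP _)).
- by rewrite capvC capv_compl.
by apply: rpred_sum => j _; rewrite rpredZ ?vbasis_mem ?memt_nth.
Qed.

HB.instance Definition _ := Lmodule_hasFinDim.Build K quotv quotv_vect_iso.

End QuotientSpace.

(* Planar rooted binary trees with internal vertices labelled by x, y, z, t. *)
Inductive op := opx | opy | opz | opt.

Inductive tree := Leaf | Node of op & tree & tree.

Definition ord_of_op (o : op) : 'I_4 :=
  match o with
  | opx => inord 0 | opy => inord 1 | opz => inord 2 | opt => inord 3
  end.
Definition op_of_ord (i : 'I_4) : op := nth opx [:: opx; opy; opz; opt] i.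
Lemma ord_of_opK : cancel ord_of_op op_of_ord.
Proof. by case; rewrite /op_of_ord /= inordK. Qed.
HB.instance Definition _ := Countable.copy op (can_type ord_of_opK).
HB.instance Definition _ : isFinite op := CanIsFinite ord_of_opK.

Fixpoint gentree_of_tree (t : tree) : GenTree.tree op :=
  match t with
  | Leaf => GenTree.Node 0 [::]
  | Node o l r =>
      GenTree.Node 1 [:: GenTree.Leaf o; gentree_of_tree l; gentree_of_tree r]
  end.
Fixpoint tree_of_gentree (g : GenTree.tree op) : tree :=
  match g with
  | GenTree.Node _ [:: GenTree.Leaf o; l; r] =>
      Node o (tree_of_gentree l) (tree_of_gentree r)
  | _ => Leaf
  end.
Lemma gentree_of_treeK : cancel gentree_of_tree tree_of_gentree.
Proof. by elim=> //= o l -> r ->. Qed.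
HB.instance Definition _ := Countable.copy tree (can_type gentree_of_treeK).

Fixpoint leaves (t : tree) : nat :=
  if t is Node _ l r then (leaves l + leaves r)%N else 1.

Lemma leaves_gt0 t : (0 < leaves t)%N.
Proof. by elim: t => //= o l IHl r _; rewrite addn_gt0 IHl. Qed.

(* Grafting s onto the leaf number i (from the left, starting at 0) of t. *)
Fixpoint graft (t : tree) (i : nat) (s : tree) : tree :=
  match t with
  | Leaf => s
  | Node o l r => if (i < leaves l)%N then Node o (graft l i s) r
                  else Node o l (graft r (i - leaves l) s)
  end.

Lemma leaves_graft t i s : (i < leaves t)%N ->
  leaves (graft t i s) = (leaves t + leaves s).-1.
Proof.
elim: t i => [|o l IHl r IHr] i //=.
have l0 := leaves_gt0 l; have r0 := leaves_gt0 r; have s0 := leaves_gt0 s.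
case: (ltnP i (leaves l)) => [il _|li ilr] /=.
  by rewrite IHl // -(prednK s0) !addnS /= addnAC.
by rewrite IHr ?ltn_subLR // -(prednK s0) !addnS /= addnA.
Qed.

Definition ntree n := {t : tree | leaves t == n}.

(* All trees of depth at most d; used only for the finiteness of ntree n. *)
Fixpoint trees_upto (d : nat) : seq tree :=
  if d is d'.+1 then
    Leaf :: [seq Node p.1 p.2.1 p.2.2 |
             p <- [seq (o, q) | o <- enum {: op},
                   q <- [seq (l, r) | l <- trees_upto d', r <- trees_upto d']]]
  else [::].

Lemma mem_trees_upto d t : (leaves t <= d)%N -> t \in trees_upto d.
Proof.
elim: d t => [|d IHd] [|o l r] //=.
  by rewrite leqn0 addn_eq0 => /andP[/eqP l0]; have := leaves_gt0 l; rewrite l0.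
move=> le_d; rewrite inE; apply/orP; right.
have l0 := leaves_gt0 l; have r0 := leaves_gt0 r.
apply/mapP; exists (o, (l, r)) => //.
apply/allpairsP; exists (o, (l, r)); split; rewrite ?mem_enum //=.
apply/allpairsP; exists (l, r); split; rewrite //= IHd // -ltnS.
  by apply: leq_trans le_d; rewrite -addn1 leq_add2l.
by apply: leq_trans le_d; rewrite -add1n leq_add2r.
Qed.

Definition ntree_enum n : seq (ntree n) := pmap insub (undup (trees_upto n)).

Lemma ntree_enumP n : Finite.axiom (ntree_enum n).
Proof.
apply: Finite.uniq_enumP; first exact: pmap_sub_uniq (undup_uniq _).
move=> t; rewrite mem_pmap_sub mem_undup mem_trees_upto //.
by rewrite (eqP (valP t)).
Qed.

HB.instance Definition _ n := Countable.on (ntree n).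
HB.instance Definition _ n := isFinite.Build (ntree n) (@ntree_enumP n).

Fact graft_subproof m n (t : ntree m) (i : 'I_m) (s : ntree n) :
  leaves (graft (val t) i (val s)) == (m + n).-1.
Proof. by rewrite leaves_graft (eqP (valP t)) ?(eqP (valP s)). Qed.

Definition ngraft m n (t : ntree m) (i : 'I_m) (s : ntree n) :
    ntree (m + n).-1 :=
  Sub (graft (val t) i (val s)) (graft_subproof t i s).

Section FreeOperad.
Variable K : fieldType.

(* freeop n is the arity n component of the free operad; freeop 0 is the zero space. *)
Definition freeop (n : nat) := {ffun ntree n -> K^o}.

Definition tree_vec n (t : ntree n) : freeop n := [ffun s => (s == t)%:R].

(* The partial composition f o_i g, with inputs numbered from 0. *)
Definition ocomp m n (f : freeop m) (i : 'I_m) (g : freeop n) : freeop (m + n).-1 :=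
  \sum_(t : ntree m) \sum_(s : ntree n) (f t * g s) *: tree_vec (ngraft t i s).

Definition operad_ideal (I : forall n, {vspace freeop n}) : Prop :=
  forall m n (f : freeop m) (i : 'I_m) (g : freeop n),
    f \in I m \/ g \in I n -> ocomp f i g \in I (m + n).-1.

Definition in_gen_ideal (R : seq (freeop 3)) n (f : freeop n) : Prop :=
  forall I, operad_ideal I -> {subset R <= I 3} -> f \in I n.

Lemma vspace_of_submod (V : vectType K) (P : V -> Prop) :
  P 0 -> (forall a u v, P u -> P v -> P (a *: u + v)) ->
  {U : {vspace V} | forall v, v \in U <-> P v}.
Proof.
move=> P0 PD; apply: cid.
pose sub (U : {vspace V}) := forall v, v \in U -> P v.
pose d k := `[< exists2 U, sub U & \dim U = k >].
have d0 : exists k, d k.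
  exists 0; apply/asboolP; exists 0%VS; last exact: dimv0.
  by move=> v; rewrite memv0 => /eqP->.
have dle k : d k -> (k <= \dim {:V})%N.
  by move=> /asboolP[U _ <-]; rewrite dimvS ?subvf.
case: (ex_maxnP d0 dle) => k /asboolP[U subU dimU] maxk; exists U => v.
split=> [/subU //|Pv].
have subUv : sub (U + <[v]>)%VS.
  move=> _ /memv_addP[u uU [_ /vlineP[a ->] ->]].
  by rewrite addrC; apply: PD => //; apply: subU.
have le_k : (\dim (U + <[v]>) <= \dim U)%N.
  by rewrite dimU; apply: maxk; apply/asboolP; exists (U + <[v]>)%VS.
have /eqP -> : U == (U + <[v]>)%VS by rewrite eqEdim addvSl.
by rewrite -[v in v \in _]add0r memv_add ?mem0v ?memv_line.
Qed.

Fact gen_ideal_subproof (R : seq (freeop 3)) n :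
  {U : {vspace freeop n} | forall f, f \in U <-> in_gen_ideal R f}.
Proof.
apply: vspace_of_submod => [I _ _|a f g If Ig I idI RI]; first exact: mem0v.
by rewrite rpredD ?rpredZ ?If ?Ig.
Qed.

(* The operadic ideal generated by R, in arity n. *)
Definition gen_ideal R n : {vspace freeop n} := sval (gen_ideal_subproof R n).

Lemma gen_idealP R n f : f \in gen_ideal R n <-> in_gen_ideal R f.
Proof. exact: svalP (gen_ideal_subproof R n) f. Qed.

Definition quot_operad R (n : nat) : vectType K := quotv (gen_ideal R n).

(* [lc o p] is o(p(a1, a2), a3) and [rc o p] is o(a1, p(a2, a3)). *)
Definition lc (o p : op) : freeop 3 :=
  tree_vec (exist (fun t => leaves t == 3) (Node o (Node p Leaf Leaf) Leaf) isT).
Definition rc (o p : op) : freeop 3 :=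
  tree_vec (exist (fun t => leaves t == 3) (Node o Leaf (Node p Leaf Leaf)) isT).

Local Notation x := opx.
Local Notation y := opy.
Local Notation z := opz.
Local Notation t := opt.

(* [e] is the sign in the last relation. *)
Definition relations (e : K) : seq (freeop 3) :=
  [:: lc x x - (rc x x + rc x t);
      lc x x - (rc x y + rc x z);
      lc x z - (rc z x + rc z t);
      lc z x - (rc z z + rc z y);
      lc z z - (rc z z + rc z y);
      lc x t - rc t x;
      lc x t - rc t z;
      lc x y - rc y x;
      lc z t - rc y z;
      lc z y - rc y z;
      (lc t x + lc t t) - rc t t;
      (lc t x + lc t t) - rc t y;
      (lc t z + lc t y) - rc y t;
      (lc y x + lc y t) - rc y y;
      (lc y z + lc y y) - rc y y;
      (lc y z - lc y x) - e *: (rc x t - rc x y)].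

Definition Xplus (n : nat) : vectType K := quot_operad (relations 1) n.
Definition Xminus (n : nat) : vectType K := quot_operad (relations (-1)) n.

End FreeOperad.

(* Main.v *)
Require Import Defs.
From HB Require Import structures.
From mathcomp Require Import all_boot all_order all_algebra.
From mathcomp Require Import generic_quotient ring_quotient boolp functions.
From mathcomp Require Import zify ring.

(* Put p = x - z and q = t - y. Relations (1)-(15) say that (z, y) and (x, t)
   are dendriform structures interacting as in a tensor product with a
   diassociative algebra; in Dend (x) Dias, whose arity n part has dimension
   n Cat_n = C(2n, n-1), both sides of (16) vanish. Their common value in an
   X+-algebra is D(a, b, c) = (a q b) y c. The arity four consequences of the
   relations let D absorb any product through any of its slots, and the arity
   five ones give (D o d) o' e = (D x d) x e if o and o' are both x or y, and
   0 otherwise. So the ideal generated by D has dimension at most one in each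
   arity n >= 5; modulo this ideal, normal forms indexed by the binary trees
   with a marked vertex span. The upper bound is attained: Dend (x) Dias
   separates the normal forms and kills D, and the commutative algebra with x
   = y the multiplication and z = t = 0, a model for the sign + only, does
   not kill D. *)

Set Implicit Arguments.
Unset Strict Implicit.
Unset Printing Implicit Defensive.
Import GRing.Theory.
Local Open Scope ring_scope.

(** The arguments of every relation occur once each and in a fixed order, so the operad can be
    recovered from an algebra on one generator: [Xalg] holds all arities at once. The identities are
    proved for arbitrary elements of an abelian group satisfying [Xlaws], where substituting
    products for arguments is free. Their coefficients are integers, so subgroups and quotient
    groups suffice; rational scalars return only in a fixed arity.

    Absorption rests on two facts: D(a, b, c) is both (a q b) y c and a x (b q c), and q vanishes as
    left factor of z and as right factor of t. Rebracketing either form therefore leaves a single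
    term.

    D uses three inputs, and two more factors are needed before all products collapse, hence the
    bound five; with one more factor the arguments below leave D x d and D y d unrelated.

    No confluence of a rewriting system is proved. Independence is checked in two stages: Dend (x)
    Dias kills D and sends normal forms to distinct basis monomials, so their coefficients vanish;
    the commutative model then handles the one remaining coefficient. *)

Section ZmodNormalization.
Variable A : zmodType.

Inductive zexp := ZVar of nat | ZAdd of zexp & zexp | ZOpp of zexp | ZZero.

Fixpoint zeval (env : seq A) e :=
  match e with
  | ZVar i => nth 0 env i
  | ZAdd e1 e2 => zeval env e1 + zeval env e2
  | ZOpp e1 => - zeval env e1
  | ZZero => 0
  end.

Fixpoint zcoef (e : zexp) (i : nat) : int :=
  match e with
  | ZVar j => (i == j)%:Z
  | ZAdd e1 e2 => zcoef e1 i + zcoef e2 i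
  | ZOpp e1 => - zcoef e1 i
  | ZZero => 0
  end.

Lemma zevalE env e :
  zeval env e = \sum_(i < size env) nth 0 env i *~ zcoef e i.
Proof.
elim: e => [j|e1 IH1 e2 IH2|e1 IH1|] /=.
- case: (ltnP j (size env)) => [jlt|jge].
    rewrite (bigD1 (Ordinal jlt)) //= eqxx mulr1z big1 ?addr0 // => i /negbTE.
    by rewrite -val_eqE /= => ->.
  rewrite nth_default // big1 // => i _.
  by rewrite ltn_eqF ?mulr0z // (leq_trans (ltn_ord i)).
- by rewrite IH1 IH2 -big_split; apply: eq_bigr => i _; rewrite mulrzDr.
- by rewrite IH1 -sumrN; apply: eq_bigr => i _; rewrite mulrNz.
- by rewrite big1 // => i _; rewrite mulr0z.
Qed.

Lemma zeval_eq env e1 e2 :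
  all (fun i => zcoef e1 i == zcoef e2 i) (iota 0 (size env)) ->
  zeval env e1 = zeval env e2.
Proof.
move=> /allP eq12; rewrite !zevalE; apply: eq_bigr => i _.
by rewrite (eqP (eq12 i _)) // mem_iota ltn_ord.
Qed.

(* [lincomb h1 .. hk] proves u = v when u - v is the sum of the lhs - rhs of the
   equations hi, as an identity between formal sums of atoms. *)
Lemma zmod_lincomb (l r u v : A) : l = r -> u + r = v + l -> u = v.
Proof. by move=> -> /addIr. Qed.

End ZmodNormalization.

Ltac zinsert u env :=
  let rec mem l := lazymatch l with
    | nil => constr:(false)
    | u :: _ => constr:(true)
    | _ :: ?l' => mem l'
    end in
  lazymatch mem env with true => env | false => constr:(u :: env) end.
Ltac zatoms e env :=
  lazymatch e with
  | (?a + ?b)%R => let env' := zatoms a env in zatoms b env'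
  | (- ?a)%R => zatoms a env
  | 0%R => env
  | _ => zinsert e env
  end.
Ltac zindex u env :=
  lazymatch env with
  | u :: _ => constr:(0%N)
  | _ :: ?l => let n := zindex u l in constr:(n.+1)
  end.
Ltac zreify e env :=
  lazymatch e with
  | (?a + ?b)%R =>
      let a' := zreify a env in let b' := zreify b env in constr:(ZAdd a' b')
  | (- ?a)%R => let a' := zreify a env in constr:(ZOpp a')
  | 0%R => constr:(ZZero)
  | _ => let n := zindex e env in constr:(ZVar n)
  end.
Ltac zmod :=
  lazymatch goal with
  | |- @eq ?A ?a ?b =>
      let env := zatoms a (@nil A) in let env := zatoms b env in
      let a' := zreify a env in let b' := zreify b env in
      apply: (@zeval_eq _ env a' b'); vm_compute; reflexivity
  end.
Tactic Notation "lincomb" constr(h) :=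
  apply: (zmod_lincomb h); zmod.
Tactic Notation "lincomb" constr(h1) constr(h2) :=
  apply: (zmod_lincomb h1); apply: (zmod_lincomb h2); zmod.
Tactic Notation "lincomb" constr(h1) constr(h2) constr(h3) :=
  apply: (zmod_lincomb h1); apply: (zmod_lincomb h2); lincomb h3.
Tactic Notation "lincomb" constr(h1) constr(h2) constr(h3) constr(h4) :=
  apply: (zmod_lincomb h1); apply: (zmod_lincomb h2); lincomb h3 h4.

Definition is_xy (o : op) : bool :=
  match o with opx | opy => true | opz | opt => false end.

Record Xlaws (A : zmodType) (m : op -> A -> A -> A) : Prop := {
  XmulDl : forall o a b c, m o (a + b) c = m o a c + m o b c;
  XmulDr : forall o a b c, m o a (b + c) = m o a b + m o a c;
  law1 : forall a b c,
    m opx (m opx a b) c = m opx a (m opx b c) + m opx a (m opt b c);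
  law2 : forall a b c,
    m opx (m opx a b) c = m opx a (m opy b c) + m opx a (m opz b c);
  law3 : forall a b c,
    m opx (m opz a b) c = m opz a (m opx b c) + m opz a (m opt b c);
  law4 : forall a b c,
    m opz (m opx a b) c = m opz a (m opz b c) + m opz a (m opy b c);
  law5 : forall a b c,
    m opz (m opz a b) c = m opz a (m opz b c) + m opz a (m opy b c);
  law6 : forall a b c, m opx (m opt a b) c = m opt a (m opx b c);
  law7 : forall a b c, m opx (m opt a b) c = m opt a (m opz b c);
  law8 : forall a b c, m opx (m opy a b) c = m opy a (m opx b c);
  law9 : forall a b c, m opz (m opt a b) c = m opy a (m opz b c);
  law10 : forall a b c, m opz (m opy a b) c = m opy a (m opz b c);
  law11 : forall a b c,
    m opt (m opx a b) c + m opt (m opt a b) c = m opt a (m opt b c);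
  law12 : forall a b c,
    m opt (m opx a b) c + m opt (m opt a b) c = m opt a (m opy b c);
  law13 : forall a b c,
    m opt (m opz a b) c + m opt (m opy a b) c = m opy a (m opt b c);
  law14 : forall a b c,
    m opy (m opx a b) c + m opy (m opt a b) c = m opy a (m opy b c);
  law15 : forall a b c,
    m opy (m opz a b) c + m opy (m opy a b) c = m opy a (m opy b c);
  law16 : forall a b c,
    m opy (m opz a b) c - m opy (m opx a b) c =
    m opx a (m opt b c) - m opx a (m opy b c)
}.

(** * Consequences of the relations in arities four and five *)

Section XAlgebra.
Variables (A : zmodType) (m : op -> A -> A -> A).
Hypothesis Xm : Xlaws m.

Local Notation "a `x b" := (m opx a b) (at level 40, left associativity).
Local Notation "a `y b" := (m opy a b) (at level 40, left associativity).
Local Notation "a `z b" := (m opz a b) (at level 40, left associativity).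
Local Notation "a `t b" := (m opt a b) (at level 40, left associativity).
Lemma Xmul0l o a : m o 0 a = 0.
Proof. by apply: (addIr (m o 0 a)); rewrite -(XmulDl Xm) !add0r. Qed.
Lemma Xmul0r o a : m o a 0 = 0.
Proof. by apply: (addIr (m o a 0)); rewrite -(XmulDr Xm) !add0r. Qed.
Lemma XmulNl o a b : m o (- a) b = - (m o a b).
Proof. by apply: (addIr (m o a b)); rewrite -(XmulDl Xm) !addNr Xmul0l. Qed.
Lemma XmulNr o a b : m o a (- b) = - (m o a b).
Proof. by apply: (addIr (m o a b)); rewrite -(XmulDr Xm) !addNr Xmul0r. Qed.
Definition XmulE := (XmulDl Xm, XmulDr Xm, XmulNl, XmulNr).

Definition diff_xz a b := a `x b - a `z b.
Definition diff_ty a b := a `t b - a `y b.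
Local Notation "a `p b" := (diff_xz a b) (at level 40, left associativity).
Local Notation "a `q b" := (diff_ty a b) (at level 40, left associativity).

(* This is the common value of the two sides of (16): see mul_py and mul_xq. *)
Definition defect a b c := (a `q b) `y c.

(** The pairs [law4]-[law5], [law9]-[law10], [law6]-[law7] and [law11]-[law12] each share a side;
    subtracting gives this lemma and the next three. *)
Lemma mul_pz a b c : (a `p b) `z c = 0.
Proof. by rewrite !XmulE (law4 Xm) (law5 Xm) subrr. Qed.
Lemma mul_qz a b c : (a `q b) `z c = 0.
Proof. by rewrite !XmulE (law9 Xm) (law10 Xm) subrr. Qed.
Lemma mul_tp a b c : a `t (b `p c) = 0.
Proof. by rewrite !XmulE -(law6 Xm) -(law7 Xm) subrr. Qed.
Lemma mul_tq a b c : a `t (b `q c) = 0.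
Proof. by rewrite !XmulE -(law11 Xm) -(law12 Xm) subrr. Qed.
Lemma mul_py a b c : (a `p b) `y c = - defect a b c.
Proof.
rewrite /defect /diff_xz /diff_ty !XmulE.
lincomb (law14 Xm a b c) (esym (law15 Xm a b c)).
Qed.
(** The sign in [law16] enters here; the opposite sign would give [- defect a b c]. *)
Lemma mul_xq a b c : a `x (b `q c) = defect a b c.
Proof.
rewrite -[RHS]opprK -mul_py /diff_xz /diff_ty !XmulE.
lincomb (esym (law16 Xm a b c)).
Qed.
Lemma mul_xp a b c : a `x (b `p c) = - defect a b c.
Proof.
rewrite -mul_xq /diff_xz /diff_ty !XmulE.
lincomb (law2 Xm a b c) (esym (law1 Xm a b c)).
Qed.

Lemma defectE a b c : defect a b c = (a `q b) `y c. Proof. by []. Qed.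
Lemma diff_xzE a b : a `p b = a `x b - a `z b. Proof. by []. Qed.
Lemma diff_tyE a b : a `q b = a `t b - a `y b. Proof. by []. Qed.

Lemma defectDl a a' b c : defect (a + a') b c = defect a b c + defect a' b c.
Proof. rewrite /defect /diff_xz /diff_ty !XmulE; zmod. Qed.
Lemma defectDm a b b' c : defect a (b + b') c = defect a b c + defect a b' c.
Proof. rewrite /defect /diff_xz /diff_ty !XmulE; zmod. Qed.
Lemma defectDr a b c c' : defect a b (c + c') = defect a b c + defect a b c'.
Proof. by rewrite /defect !XmulE. Qed.
Lemma defectNl a b c : defect (- a) b c = - defect a b c.
Proof. rewrite /defect /diff_xz /diff_ty !XmulE; zmod. Qed.
Lemma defectNm a b c : defect a (- b) c = - defect a b c.
Proof. rewrite /defect /diff_xz /diff_ty !XmulE; zmod. Qed.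
Lemma defectNr a b c : defect a b (- c) = - defect a b c.
Proof. by rewrite /defect !XmulE. Qed.
Definition defect_additive :=
  (defectDl, defectDm, defectDr, defectNl, defectNm, defectNr).

(** Rebracketing (a q b) y c against d yields at most one extra term, which contains (a q b) z c =
    0. *)
Lemma defect_mulr o a b c d : m o (defect a b c) d = defect a b (m o c d).
Proof.
rewrite [RHS]defectE [X in m o X]defectE; case: o.
- exact: law8.
- by rewrite -(law15 Xm) mul_qz Xmul0l add0r.
- exact: law10.
- by rewrite -(law13 Xm) mul_qz Xmul0l add0r.
Qed.

(** Mirror argument on the form b x (c q d); the extra term contains b t (c q d) = 0. *)
Lemma defect_mull o a b c d : m o a (defect b c d) = defect (m o a b) c d.
Proof.
rewrite -[RHS]mul_xq -[in LHS]mul_xq; case: o.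
- by rewrite (law1 Xm) mul_tq Xmul0r addr0.
- by rewrite (law8 Xm).
- by rewrite (law3 Xm) mul_tq Xmul0r addr0.
- by rewrite (law6 Xm).
Qed.

(** With the left defect read as a x (b q c) and the right one as (b q c) y d, both sides are
    bracketings of a, b q c, d. *)
Lemma defect_shift o a b c d : m o (defect a b c) d = m o a (defect b c d).
Proof.
rewrite (defectE b) -mul_xq; case: o.
- by rewrite (law2 Xm) mul_qz Xmul0r addr0.
- by rewrite -(law14 Xm) mul_tq Xmul0l addr0.
- by rewrite (law4 Xm) mul_qz Xmul0r add0r.
- by rewrite -(law12 Xm) mul_tq Xmul0l addr0.
Qed.

Section MiddleArgument.
Variables a b c d : A.
Let D o := m o (defect a b c) d.
Let M o := defect a (m o b c) d.

(** This and the next five equations come from expanding an arity four element in two ways. These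
    six linear relations among the eight elements [D o], [M o] force [D o = M o] and leave at most
    two independent values. *)
Let Dp_My : D opx - D opz = M opy.
Proof.
have -> : D opx - D opz = defect a b (c `p d).
  by rewrite diff_xzE !defect_additive -!defect_mulr.
have ty : a `x (b `t (c `p d)) = 0 by rewrite mul_tp Xmul0r.
have e1 : b `y (c `p d) = (b `y c) `p d.
  by rewrite /diff_xz /diff_ty !XmulE (law8 Xm) (law10 Xm).
rewrite -mul_xq diff_tyE XmulE XmulE ty e1 mul_xp /M; zmod.
Qed.

Let Dp_Mxt : D opx - D opz = M opx + M opt.
Proof.
have -> : D opx - D opz = defect (a `p b) c d.
  by rewrite diff_xzE !defect_additive -!defect_mull -!defect_shift.
have e1 : (a `p b) `x c = a `p (b `x c) + a `p (b `t c).
  rewrite /diff_xz /diff_ty !XmulE (law1 Xm) (law3 Xm); zmod.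
have e2 : (((a `p b) `x c) `y d) = - defect (a `p b) c d.
  have z0 : ((a `p b) `z c) `y d = 0 by rewrite mul_pz Xmul0l.
  rewrite -mul_py [in RHS](diff_xzE _ c) (XmulDl Xm) XmulNl z0; zmod.
apply: oppr_inj; rewrite -e2 e1 XmulE !mul_py /M; zmod.
Qed.

Let Dq_Mx : D opt - D opy = - M opx.
Proof.
have -> : D opt - D opy = defect (a `q b) c d.
  by rewrite diff_tyE !defect_additive -!defect_mull -!defect_shift.
have e1 : (a `q b) `x c = a `q (b `x c).
  by rewrite /diff_xz /diff_ty !XmulE (law6 Xm) (law8 Xm).
have z0 : ((a `q b) `z c) `y d = 0 by rewrite mul_qz Xmul0l.
have := mul_py (a `q b) c d.
rewrite (diff_xzE _ c) (XmulDl Xm) XmulNl z0 e1 -defectE.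
by rewrite -/(M opx) subr0 => ->; rewrite opprK.
Qed.

Let Dz_Mt : D opz = - M opt.
Proof.
have e1 : (b `q c) `p d = b `q (c `z d) - b `y (c `p d).
  rewrite diff_xzE mul_qz /diff_xz /diff_ty !XmulE.
  lincomb (law7 Xm b c d) (esym (law8 Xm b c d)).
have e2 : b `y (c `p d) = (b `y c) `p d.
  by rewrite /diff_xz /diff_ty !XmulE (law8 Xm) (law10 Xm).
have := congr1 (m opx a) e1.
rewrite mul_xp XmulE XmulNr mul_xq e2 mul_xp diff_tyE !defect_additive.
rewrite -defect_mulr => h; rewrite /D /M; lincomb (esym h).
Qed.

Let Dt_Mz : D opt = - M opz.
Proof.
have e1 : a `q (b `p c) = (a `q b) `x c - (a `t b) `p c.
  rewrite diff_tyE mul_tp /diff_xz /diff_ty !XmulE.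
  lincomb (law8 Xm a b c) (esym (law9 Xm a b c)).
have e2 : (a `q b) `x c = a `q (b `x c).
  by rewrite /diff_xz /diff_ty !XmulE (law6 Xm) (law8 Xm).
have := congr1 (fun u => u `y d) e1.
rewrite -defectE XmulE XmulNl e2 -defectE mul_py diff_xzE !defect_additive.
rewrite -defect_mull -defect_shift => h; rewrite /D /M; lincomb (esym h).
Qed.

Let MxE : M opx = M opz + M opy.
Proof.
have tq : a `x (b `t (c `q d)) = 0 by rewrite mul_tq Xmul0r.
have e1 : b `y (c `q d) = (b `z c) `q d + (b `y c) `q d.
  rewrite /diff_ty !XmulE.
  lincomb (esym (law13 Xm b c d)) (law15 Xm b c d).
have e2 : D opt - D opy = - (M opz + M opy).
  have -> : D opt - D opy = defect a b (c `q d).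
    by rewrite diff_tyE !defect_additive -!defect_mulr.
  rewrite -mul_xq (diff_tyE b) XmulE XmulNr tq e1 XmulE !mul_xq /M; zmod.
by apply: oppr_inj; rewrite -e2 -Dq_Mx.
Qed.

Lemma defect_mulm o : m o (defect a b c) d = defect a (m o b c) d.
Proof.
rewrite -/(D o) -/(M o); case: o.
- lincomb Dz_Mt Dp_Mxt.
- lincomb (esym Dq_Mx) Dt_Mz MxE.
- lincomb Dz_Mt (esym Dp_My) Dp_Mxt MxE.
- lincomb Dt_Mz (esym Dp_My) Dp_Mxt MxE.
Qed.

Lemma defect_mulz : D opz = D opx - D opy.
Proof. rewrite /D !defect_mulm -!/(M _); lincomb (esym MxE). Qed.

Lemma defect_mult : D opt = D opy - D opx.
Proof.
have -> : D opy = M opy by rewrite /D defect_mulm.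
have -> : D opx = M opx by rewrite /D defect_mulm.
have -> : D opt = M opt by rewrite /D defect_mulm.
lincomb Dp_My (esym Dp_Mxt).
Qed.

End MiddleArgument.

(** The inner product is stored in the first slot of a defect and the outer one in the middle slot;
    they can then be released in the other order. *)
Lemma defect_mulC o o' a b c d e :
  m o' (m o (defect a b c) d) e = m o (m o' (defect a b c) d) e.
Proof.
by rewrite [in LHS]defect_shift [in LHS]defect_mull [in LHS]defect_mulm
  -[in LHS]defect_mull -[in LHS]defect_shift -[in LHS]defect_mulr.
Qed.

Section TwoProducts.
Variables a b c d e : A.
Let D := defect a b c.

(** As left factors of z, D x d and D z d agree, while by [defect_mulz] they differ by D y d. *)
Let Dyz : (D `y d) `z e = 0.
Proof.
have Dtz : (D `t d) `z e = (D `y d) `z e by rewrite (law9 Xm) (law10 Xm).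
have Dxz : (D `x d) `z e = (D `z d) `z e by rewrite (law4 Xm) (law5 Xm).
move: Dtz Dxz; rewrite /D !defect_mult !defect_mulz !XmulE => h1 h2.
lincomb h2.
Qed.

Let Dxz : (D `x d) `z e = 0.
Proof.
have : (D `t d) `z e = (D `y d) `z e by rewrite (law9 Xm) (law10 Xm).
rewrite /D defect_mult !XmulE -/D Dyz add0r => /eqP.
by rewrite oppr_eq0 => /eqP.
Qed.

Let Dz o : (m o D d) `z e = 0.
Proof.
case: o; rewrite ?Dxz ?Dyz //.
  by rewrite /D defect_mulz -/D !XmulE Dxz Dyz subr0.
by rewrite /D defect_mult -/D !XmulE Dxz Dyz subr0.
Qed.

(** [m o D d] is itself a defect, so [defect_mulz] turns the vanishing of its z-products into this
    equality. *)
Let Dy o : (m o D d) `y e = (m o D d) `x e.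
Proof.
have := Dz o; rewrite /D defect_mulr defect_mulz -defect_mulr -/D => /eqP.
by rewrite subr_eq0 => /eqP.
Qed.

Let Dt o : (m o D d) `t e = 0.
Proof.
have := Dy o.
by rewrite /D defect_mulr defect_mult -defect_mulr -/D => ->; rewrite subrr.
Qed.

Lemma defect_mul2 o o' : m o' (m o D d) e =
  if is_xy o && is_xy o' then (D `x d) `x e else 0.
Proof.
have xE : (m o D d) `x e = if is_xy o then (D `x d) `x e else 0.
  by rewrite /D (defect_mulC o opx) -/D; case: o; rewrite ?Dz ?Dt ?Dy.
by case: o'; rewrite ?andbT ?andbF ?Dz ?Dt ?Dy.
Qed.
End TwoProducts.

End XAlgebra.

(** * Subgroups and quotient algebras *)

Inductive zspan (A : zmodType) (G : A -> Prop) : A -> Prop :=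
| zspan0 : zspan G 0
| zspanD g a : G g -> zspan G a -> zspan G (a + g)
| zspanB g a : G g -> zspan G a -> zspan G (a - g).

Section Span.
Variable A : zmodType.
Implicit Types G H P : A -> Prop.

Lemma zspan_min G P : P 0 -> (forall a b, P a -> P b -> P (a - b)) ->
  (forall g, G g -> P g) -> forall a, zspan G a -> P a.
Proof.
move=> P0 PB GP a; elim=> [|g b Gg _ Pb|g b Gg _ Pb] //.
  rewrite -[g]opprK; apply: (PB) => //.
  by rewrite -[- g]sub0r; apply: (PB); auto.
by apply: (PB); auto.
Qed.

Lemma zspan_gen G g : G g -> zspan G g.
Proof. by move=> Gg; rewrite -[g]add0r; apply: zspanD => //; apply: zspan0. Qed.

Lemma zspan_add G a b : zspan G a -> zspan G b -> zspan G (a + b).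
Proof.
move=> Ga; elim=> {b} [|g b Gg _ Gab|g b Gg _ Gab]; first by rewrite addr0.
  by rewrite addrA; apply: zspanD.
by rewrite addrA; apply: zspanB.
Qed.

Lemma zspan_opp G a : zspan G a -> zspan G (- a).
Proof.
elim=> {a} [|g a Gg _ Ga|g a Gg _ Ga]; first by rewrite oppr0; apply: zspan0.
  by rewrite opprD; apply: zspanB.
by rewrite opprB addrC; apply: zspanD.
Qed.

Lemma zspan_sub G a b : zspan G a -> zspan G b -> zspan G (a - b).
Proof. by move=> Ga Gb; apply: zspan_add => //; apply: zspan_opp. Qed.

End Span.

Lemma zspan_map (A B : zmodType) (f : A -> B) (G : A -> Prop) (H : B -> Prop) :
  {morph f : a b / a - b} -> (forall g, G g -> zspan H (f g)) ->
  forall a, zspan G a -> zspan H (f a).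
Proof.
move=> fB GH; apply: zspan_min => [|a b Ha Hb|//].
  by rewrite -(subrr 0) fB subrr; apply: zspan0.
by rewrite fB; apply: zspan_sub.
Qed.

Lemma zspan_lift (A B : zmodType) (f : A -> B) (G : A -> Prop) b :
  {morph f : a a' / a - a'} ->
  zspan (fun b' => exists2 g, G g & b' = f g) b ->
  exists2 a, zspan G a & f a = b.
Proof.
move=> fB; move: b.
have f0 : f 0 = 0 by rewrite -(subrr 0) fB subrr.
apply: zspan_min => [|_ _ [a Ga <-] [a' Ga' <-]|_ [g Gg ->]].
- by exists 0 => //; apply: zspan0.
- by exists (a - a') => //; apply: zspan_sub.
- by exists g => //; apply: zspan_gen.
Qed.

Fixpoint ev (A : Type) (m : op -> A -> A -> A) (rho : nat -> A) (t : tree) :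
    A :=
  if t is Node o l r then
    m o (ev m rho l) (ev m (fun i => rho (leaves l + i)%N) r)
  else rho 0.

Section DefectIdeal.
Variables (A : zmodType) (m : op -> A -> A -> A).
Hypothesis Xm : Xlaws m.
Variable a : A.
Local Notation gen := (ev m (fun=> a)).
Local Notation defect := (defect m).

Definition word (w : seq op) : A := foldl (fun b o => m o b a) (defect a a a) w.

Lemma word_rcons w o : word (rcons w o) = m o (word w) a.
Proof. by rewrite /word foldl_rcons. Qed.

(** Words keep the shape of a defect, so the absorption laws continue to apply to them. *)
Lemma word_defect w : exists t, word w = defect a a (gen t).
Proof.
elim/last_ind: w => [|w o [t wt]]; first by exists Leaf.
by exists (Node o t Leaf); rewrite word_rcons wt defect_mulr.
Qed.

Lemma word_mul2 w o o' : m o' (m o (word w) a) a =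
  if is_xy o && is_xy o' then m opx (m opx (word w) a) a else 0.
Proof. by have [t ->] := word_defect w; apply: defect_mul2. Qed.

(** The word must be nonempty: [defect_mul2] normalizes two products together, never the first one
    alone. *)
Lemma word_mulx o w : m opx (word (o :: w)) a =
  if all is_xy (o :: w) then word (nseq (size w).+2 opx) else 0.
Proof.
have xx k : m opx (word (nseq k opx)) a = word (nseq k.+1 opx).
  by rewrite -addn1 nseqD -word_rcons cats1.
elim/last_ind: w => [|w o' IHw].
  by rewrite -[[:: o]]/(rcons [::] o) word_rcons word_mul2 /= !andbT.
rewrite -rcons_cons word_rcons word_mul2 andbT IHw all_rcons size_rcons.
case: (is_xy o'); case: (all _ _) => //=; rewrite ?(Xmul0l Xm) //.
exact: (xx (size w).+2).
Qed.

Lemma word_long w : (2 <= size w)%N ->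
  word w = if all is_xy w then word (nseq (size w) opx) else 0.
Proof.
case: w => [//|o1 w]; case/lastP: w => [//|w o] _.
rewrite -rcons_cons word_rcons all_rcons size_rcons.
have -> : m o (word (o1 :: w)) a =
    if is_xy o then m opx (word (o1 :: w)) a else 0.
  rewrite lastI word_rcons word_mul2 (word_mul2 _ (last o1 w) opx).
  by case: (is_xy o); rewrite ?andbF // andbT.
by rewrite word_mulx; case: (is_xy o).
Qed.

Let K := zspan (fun b => exists w, b = word w).

Let K_word w : K (word w). Proof. by apply: zspan_gen; exists w. Qed.

Let K_map (f : A -> A) : {morph f : b c / b - c} ->
  (forall w, K (f (word w))) -> forall b, K b -> K (f b).
Proof. by move=> fB Kf b; apply: (zspan_map fB) => _ [w ->]; apply: Kf. Qed.

Let mulrB o v : {morph (fun b => m o b v) : b c / b - c}.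
Proof. by move=> b c; rewrite !(XmulE Xm). Qed.
Let mullB o v : {morph m o v : b c / b - c}.
Proof. by move=> b c; rewrite !(XmulE Xm). Qed.

Lemma word_mulr o v b : K b -> K (m o b (gen v)).
Proof.
elim: v o b => [|o' v1 IH1 v2 IH2] o b; apply: (K_map (mulrB o _)) => w.
  by rewrite /= -word_rcons.
have [t wt] := word_defect w; rewrite [gen _]/=.
(* Absorption moves [o'] from between [v1] and [v2] to between the word and [v1]: multiplying by a
   product becomes multiplying twice. *)
suff -> : m o (word w) (m o' (gen v1) (gen v2)) =
    m o (m o' (word w) (gen v1)) (gen v2) by apply/IH2/IH1.
rewrite wt (defect_shift Xm) -(defect_mulr Xm) (defect_shift Xm o').
by rewrite (defect_mull Xm) -(defect_shift Xm) -(defect_mulm Xm).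
Qed.

Lemma defect_span u v w : K (defect (gen u) (gen v) (gen w)).
Proof.
elim: u v w => [|o u1 IH1 u2 _] v w; last first.
  by rewrite -(defect_mull Xm) -(defect_shift Xm); apply: word_mulr.
elim: v w => [|o v1 IH1 v2 _] w.
  elim: w => [|o w1 IH1 w2 _]; first exact: (K_word [::]).
  by rewrite -(defect_mulr Xm); apply: word_mulr.
by rewrite -(defect_mulm Xm); apply: word_mulr.
Qed.

(** [defect_shift] exchanges the left factor for the first slot, which turns the product into a
    right multiplication by the last slot. *)
Lemma word_mull o v b : K b -> K (m o (gen v) b).
Proof.
move: b; apply: (K_map (mullB o _)) => w; have [t ->] := word_defect w.
rewrite -(defect_shift Xm); apply: (@word_mulr _ t).
exact: (defect_span v Leaf Leaf).
Qed.
End DefectIdeal.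

Record subgroup (A : zmodType) := Subgroup {
  subgroup_in :> A -> Prop;
  subgroup0 : subgroup_in 0;
  subgroupB : forall a b, subgroup_in a -> subgroup_in b -> subgroup_in (a - b)
}.

Section Quotient.
Variables (A : zmodType) (S : subgroup A).

Definition subgroup_pred : {pred A} := fun a => `[< S a >].

Fact subgroup_pred_closed : zmod_closed subgroup_pred.
Proof.
split=> [|a b /asboolP Sa /asboolP Sb]; apply/asboolP; first exact: subgroup0.
exact: subgroupB.
Qed.
HB.instance Definition _ :=
  GRing.isZmodClosed.Build A subgroup_pred subgroup_pred_closed.

(** Used for two subgroups: the span of the words, and the operadic ideal. *)
Definition zquot : Type := Quotient.quot subgroup_pred.
HB.instance Definition _ := ZmodQuotient.on zquot.

Definition zpi (a : A) : zquot := (\pi_zquot a)%qT.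

Lemma zpiD a b : zpi (a + b) = zpi a + zpi b. Proof. exact: raddfD. Qed.
Lemma zpiB a b : zpi (a - b) = zpi a - zpi b. Proof. exact: raddfB. Qed.
Lemma zpi_repr u : zpi (repr u) = u. Proof. exact: reprK. Qed.
Lemma zpi_eq a b : zpi a = zpi b <-> S (a - b).
Proof.
have -> : S (a - b) <-> a - b \in subgroup_pred by split=> /asboolP.
rewrite -[a - b \in _]/(a - b \in (subgroup_pred : zmodClosed A)).
by rewrite [in X in _ <-> X]Quotient.idealrBE; split=> /eqP.
Qed.
Lemma zpi_eq0 a : zpi a = 0 <-> S a.
Proof.
have <- : zpi 0 = 0 :> zquot by exact: raddf0.
by rewrite zpi_eq subr0.
Qed.

Variable m : op -> A -> A -> A.
Hypothesis mDl : forall o a b c, m o (a + b) c = m o a c + m o b c.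
Hypothesis mDr : forall o a b c, m o a (b + c) = m o a b + m o a c.
Hypothesis Sl : forall o a b, S a -> S (m o a b).
Hypothesis Sr : forall o a b, S b -> S (m o a b).

Definition zquot_mul o (u v : zquot) : zquot := zpi (m o (repr u) (repr v)).

Lemma zquot_mulE o a b : zquot_mul o (zpi a) (zpi b) = zpi (m o a b).
Proof.
have repr_sub c : S (repr (zpi c) - c) by apply/zpi_eq/zpi_repr.
transitivity (zpi (m o a (repr (zpi b)))); apply/zpi_eq.
  rewrite -[X in m o X _ - _](subrK a) mDl addrK; exact: Sl.
rewrite -[X in m o _ X - _](subrK b) mDr addrK; exact: Sr.
Qed.

End Quotient.

(** Same order and signs as [relations 1], so that evaluating the generators of the ideal produces
    exactly this list. *)
Definition Xdefects (A : zmodType) (m : op -> A -> A -> A) (a b c : A) :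
    seq A :=
  let l o p := m o (m p a b) c in
  let r o p := m o a (m p b c) in
  [:: l opx opx - (r opx opx + r opx opt);
      l opx opx - (r opx opy + r opx opz);
      l opx opz - (r opz opx + r opz opt);
      l opz opx - (r opz opz + r opz opy);
      l opz opz - (r opz opz + r opz opy);
      l opx opt - r opt opx;
      l opx opt - r opt opz;
      l opx opy - r opy opx;
      l opz opt - r opy opz;
      l opz opy - r opy opz;
      (l opt opx + l opt opt) - r opt opt;
      (l opt opx + l opt opt) - r opt opy;
      (l opt opz + l opt opy) - r opy opt;
      (l opy opx + l opy opt) - r opy opy;
      (l opy opz + l opy opy) - r opy opy;
      (l opy opz - l opy opx) - (r opx opt - r opx opy)].

Lemma Xlaws_of_defects (A : zmodType) (m : op -> A -> A -> A) :
  (forall o a b c, m o (a + b) c = m o a c + m o b c) ->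
  (forall o a b c, m o a (b + c) = m o a b + m o a c) ->
  (forall a b c, Xdefects m a b c = nseq 16 0) -> Xlaws m.
Proof.
move=> mDl mDr X0.
have X k a b c : nth 0 (Xdefects m a b c) k = 0 by rewrite X0 nth_nseq if_same.
split=> [//|//|a b c|a b c|a b c|a b c|a b c|a b c|a b c|a b c|a b c|a b c
  |a b c|a b c|a b c|a b c|a b c|a b c]; apply: subr0_eq.
- exact: (X 0%N).
- exact: (X 1%N).
- exact: (X 2%N).
- exact: (X 3%N).
- exact: (X 4%N).
- exact: (X 5%N).
- exact: (X 6%N).
- exact: (X 7%N).
- exact: (X 8%N).
- exact: (X 9%N).
- exact: (X 10%N).
- exact: (X 11%N).
- exact: (X 12%N).
- exact: (X 13%N).
- exact: (X 14%N).
- exact: (X 15%N).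
Qed.

Lemma Xdefects0 (A : zmodType) (m : op -> A -> A -> A) a b c :
  Xlaws m -> Xdefects m a b c = nseq 16 0.
Proof.
move=> Xm; have e (u v : A) : u = v -> u - v = 0 by move=> ->; rewrite subrr.
rewrite /Xdefects (e _ _ (law1 Xm a b c)) (e _ _ (law2 Xm a b c)).
rewrite (e _ _ (law3 Xm a b c)) (e _ _ (law4 Xm a b c)) (e _ _ (law5 Xm a b c)).
rewrite (e _ _ (law6 Xm a b c)) (e _ _ (law7 Xm a b c)) (e _ _ (law8 Xm a b c)).
rewrite (e _ _ (law9 Xm a b c)) (e _ _ (law10 Xm a b c)).
rewrite (e _ _ (law11 Xm a b c)) (e _ _ (law12 Xm a b c)).
rewrite (e _ _ (law13 Xm a b c)) (e _ _ (law14 Xm a b c)).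
by rewrite (e _ _ (law15 Xm a b c)) (e _ _ (law16 Xm a b c)).
Qed.

Lemma Xlaws_zquot (A : zmodType) (S : subgroup A) (m : op -> A -> A -> A) :
  (forall o a b c, m o (a + b) c = m o a c + m o b c) ->
  (forall o a b c, m o a (b + c) = m o a b + m o a c) ->
  (forall o a b, S a -> S (m o a b)) ->
  (forall o a b, S b -> S (m o a b)) ->
  (forall a b c, map (@zpi A S) (Xdefects m a b c) = nseq 16 0) ->
  Xlaws (@zquot_mul A S m).
Proof.
move=> mDl mDr Sl Sr X0.
have XmulE := zquot_mulE mDl mDr Sl Sr.
apply: Xlaws_of_defects => [o u v w|o u v w|u v w].
- by rewrite -[u]zpi_repr -[v]zpi_repr -[w]zpi_repr -zpiD !XmulE mDl zpiD.
- by rewrite -[u]zpi_repr -[v]zpi_repr -[w]zpi_repr -zpiD !XmulE mDr zpiD.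
rewrite -[u]zpi_repr -[v]zpi_repr -[w]zpi_repr -(X0 (repr u) (repr v) (repr w)).
by rewrite /Xdefects /= !XmulE !zpiB !zpiD.
Qed.

(** * Normal forms modulo the defect *)

Inductive bt := BLeaf | BNode of bt & bt.

Fixpoint tree_of_bt (T : bt) : tree :=
  if T is BNode l r then Node opx (tree_of_bt l) (tree_of_bt r) else Leaf.
Fixpoint bt_of_tree (t : tree) : bt :=
  if t is Node _ l r then BNode (bt_of_tree l) (bt_of_tree r) else BLeaf.
Lemma tree_of_btK : cancel tree_of_bt bt_of_tree.
Proof. by elim=> //= l -> r ->. Qed.
HB.instance Definition _ := Equality.copy bt (can_type tree_of_btK).

Fixpoint bsize (T : bt) : nat :=
  if T is BNode l r then (bsize l + bsize r).+1 else 0.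

(** [BNode l r] stands for the dendriform monomial (l > a) < r, in which an empty subtree is
    omitted; hence [Leaf], the generator itself, when [l] is empty. *)
Definition graft_left o (l : bt) (t : tree) : tree :=
  if l is BLeaf then Leaf else Node o t Leaf.
Definition graft_right o (t : tree) (r : bt) (t' : tree) : tree :=
  if r is BLeaf then t else Node o t t'.

(* The vertices of T are numbered from 0 in infix order. The operations between
   the marked vertex i and the root point towards it; a subtree that does not
   contain i gets the mark 0, and any other choice would do (cf. nf_indep). *)
Fixpoint nf (T : bt) (i : nat) : tree :=
  if T is BNode l r then
    if (i < bsize l)%N then
      graft_right opx (graft_left opt l (nf l i)) r (nf r 0)
    else if i == bsize l then
      graft_right opx (graft_left opy l (nf l 0)) r (nf r 0)
    else
      graft_right opz (graft_left opy l (nf l 0)) r (nf r (i - (bsize l).+1))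
  else Leaf.

Lemma leaves_nf T i : (0 < bsize T)%N -> leaves (nf T i) = bsize T.
Proof.
elim: T i => [//|l IHl r IHr] i _ /=.
have leftE o j : leaves (graft_left o l (nf l j)) = (bsize l).+1.
  by case: l IHl => //= l1 l2 IHl; rewrite IHl //= addn1.
have rightE o t j :
    leaves (graft_right o t r (nf r j)) = (leaves t + bsize r)%N.
  by case: r IHr => [|r1 r2] IHr /=; rewrite ?IHr ?addn0.
by case: ifP => _; [|case: ifP => _]; rewrite rightE leftE.
Qed.

Lemma nf_node l r i : nf (BNode l r) i =
  if (i < bsize l)%N then
    graft_right opx (graft_left opt l (nf l i)) r (nf r 0)
  else if i == bsize l then
    graft_right opx (graft_left opy l (nf l 0)) r (nf r 0)
  else
    graft_right opz (graft_left opy l (nf l 0)) r (nf r (i - (bsize l).+1)).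
Proof. by []. Qed.

Arguments nf : simpl never.

Section Spanning.
Variables (A : zmodType) (m : op -> A -> A -> A).
Hypothesis Xm : Xlaws m.
Hypothesis defect0 : forall b c d, defect m b c d = 0.
Variable a : A.
Local Notation e T i := (ev m (fun=> a) (nf T i)).
Local Notation "b `x c" := (m opx b c) (at level 40, left associativity).
Local Notation "b `y c" := (m opy b c) (at level 40, left associativity).
Local Notation "b `z c" := (m opz b c) (at level 40, left associativity).
Local Notation "b `t c" := (m opt b c) (at level 40, left associativity).

Definition lmul o l i := if l is BLeaf then a else m o (e l i) a.
Definition rmul o b r i := if r is BLeaf then b else m o b (e r i).

Lemma ev_nf l r i : e (BNode l r) i =
  if (i < bsize l)%N then rmul opx (lmul opt l i) r 0
  else if i == bsize l then rmul opx (lmul opy l 0) r 0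
  else rmul opz (lmul opy l 0) r (i - (bsize l).+1)%N.
Proof.
by rewrite nf_node; case: ifP => _; [|case: ifP => _]; case: l; case: r.
Qed.

(** In Dend (x) Dias, z and y forget the mark of their left factor, x and t that of their right
    factor. These elements vanish once their mark is forgotten, so [cong] is equality up to the
    position of the mark. *)
Definition annihilated b :=
  forall c, [/\ b `z c = 0, b `y c = 0, c `x b = 0 & c `t b = 0].

Definition cong b c := annihilated (b - c).

Lemma annihilatedB b c : annihilated b -> annihilated c -> annihilated (b - c).
Proof.
move=> Jb Jc d; have [b1 b2 b3 b4] := Jb d; have [c1 c2 c3 c4] := Jc d.
by split; rewrite !(XmulE Xm) ?b1 ?b2 ?b3 ?b4 ?c1 ?c2 ?c3 ?c4 subrr.
Qed.

Lemma annihilatedN b : annihilated b -> annihilated (- b).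
Proof.
move=> Jb c; have [b1 b2 b3 b4] := Jb c.
by split; rewrite !(XmulE Xm) ?b1 ?b2 ?b3 ?b4 oppr0.
Qed.

Lemma annihilated_xz b c : annihilated (b `x c - b `z c).
Proof.
move=> d; split; rewrite -/(diff_xz m b c).
- exact: mul_pz.
- by rewrite (mul_py Xm) defect0 oppr0.
- by rewrite (mul_xp Xm) defect0 oppr0.
- exact: mul_tp.
Qed.

Lemma annihilated_ty b c : annihilated (b `t c - b `y c).
Proof.
move=> d; split; rewrite -/(diff_ty m b c).
- exact: mul_qz.
- exact: defect0.
- by rewrite (mul_xq Xm) defect0.
- exact: mul_tq.
Qed.

(** Two of the products are zero outright, and x and t differ from them by annihilated elements. *)
Lemma annihilated_mulr o b c : annihilated b -> annihilated (m o b c).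
Proof.
move=> Jb; have [b1 b2 _ _] := Jb c.
have J0 : annihilated 0 by move=> d; rewrite !(Xmul0l Xm) !(Xmul0r Xm).
case: o; rewrite ?b1 ?b2 //.
- by have := annihilated_xz b c; rewrite b1 subr0.
- by have := annihilated_ty b c; rewrite b2 subr0.
Qed.

Lemma annihilated_mull o b c : annihilated c -> annihilated (m o b c).
Proof.
move=> Jc; have [_ _ c1 c2] := Jc b.
have J0 : annihilated 0 by move=> d; rewrite !(Xmul0l Xm) !(Xmul0r Xm).
case: o; rewrite ?c1 ?c2 //.
- by have := annihilatedN (annihilated_ty b c); rewrite c2 sub0r opprK.
- by have := annihilatedN (annihilated_xz b c); rewrite c1 sub0r opprK.
Qed.

Lemma cong_refl b : cong b b.
Proof. by rewrite /cong subrr => d; rewrite !(Xmul0l Xm) !(Xmul0r Xm). Qed.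

Lemma cong_trans b c d : cong b c -> cong c d -> cong b d.
Proof.
move=> bc cd; have -> : cong b d = annihilated ((b - c) - (- (c - d))).
  by congr annihilated; zmod.
by apply: annihilatedB => //; apply: annihilatedN.
Qed.

Lemma cong_sym b c : cong b c -> cong c b.
Proof. by move=> bc; rewrite /cong -opprB; apply: annihilatedN. Qed.

Lemma cong_mul o b b' c c' :
  cong b b' -> cong c c' -> cong (m o b c) (m o b' c').
Proof.
move=> bb' cc'; apply: (@cong_trans _ (m o b' c)); rewrite /cong.
  by rewrite -(XmulNl Xm) -(XmulDl Xm); apply: annihilated_mulr.
by rewrite -(XmulNr Xm) -(XmulDr Xm); apply: annihilated_mull.
Qed.

Lemma cong_eq b b' c : cong b b' ->
  [/\ b `z c = b' `z c, b `y c = b' `y c, c `x b = c `x b' & c `t b = c `t b'].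
Proof.
move=> /(_ c) [] h1 h2 h3 h4.
split; apply: subr0_eq.
- by rewrite -(XmulNl Xm) -(XmulDl Xm).
- by rewrite -(XmulNl Xm) -(XmulDl Xm).
- by rewrite -(XmulNr Xm) -(XmulDr Xm).
- by rewrite -(XmulNr Xm) -(XmulDr Xm).
Qed.

Lemma cong_lmul l i j : (forall i j, (0 < bsize l)%N -> cong (e l i) (e l j)) ->
  cong (lmul opt l i) (lmul opy l j) /\ cong (lmul opy l i) (lmul opy l j).
Proof.
case: l => [|l1 l2] ll; first by split; apply: cong_refl.
have lt := cong_mul opt (ll i j isT) (cong_refl a).
have ly := cong_mul opy (ll i j isT) (cong_refl a).
by split=> //; apply: cong_trans lt _; apply: annihilated_ty.
Qed.

Lemma cong_nf T i j : (0 < bsize T)%N -> cong (e T i) (e T j).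
Proof.
elim: T i j => [//|l IHl r IHr] i j _.
(* A reference element independent of the mark: at the root, x is traded for z and t for y, and the
   subtrees are marked at 0. *)
suff canon k : cong (e (BNode l r) k) (rmul opz (lmul opy l 0) r 0).
  by apply: cong_trans (canon i) _; apply: cong_sym; apply: canon.
have [lt ly] : (forall k, cong (lmul opt l k) (lmul opy l 0)) /\
    (forall k, cong (lmul opy l k) (lmul opy l 0)).
  by split=> k'; have [] := @cong_lmul l k' 0%N IHl.
have rx b c : cong b c -> cong (rmul opx b r 0) (rmul opz c r 0).
  case: r {IHr} => [//|r1 r2] bc; apply: cong_trans (annihilated_xz _ _) _.
  by apply: cong_mul => //; apply: cong_refl.
rewrite ev_nf; case: ifP => _; first exact: rx.
case: ifP => _; first by apply: rx; apply: cong_refl.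
case: r IHr {rx} => [_|r1 r2 IHr]; first exact: cong_refl.
by apply: cong_mul; [apply: cong_refl|apply: IHr].
Qed.

Lemma nf_indep T i j b : (0 < bsize T)%N ->
  [/\ e T i `z b = e T j `z b, e T i `y b = e T j `y b,
      b `x e T i = b `x e T j & b `t e T i = b `t e T j].
Proof. by move=> T0; apply/cong_eq/cong_nf. Qed.

Definition nf_elt n b :=
  exists T i, [/\ bsize T = n, (i < n)%N & b = e T i].
Local Notation S n := (zspan (nf_elt n)).

Let mulrB o v : {morph (fun b => m o b v) : b c / b - c}.
Proof. by move=> b c; rewrite !(XmulE Xm). Qed.
Let mullB o v : {morph m o v : b c / b - c}.
Proof. by move=> b c; rewrite !(XmulE Xm). Qed.
Let rmulB o r i : {morph (fun b => rmul o b r i) : b c / b - c}.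
Proof. by case: r => [|r1 r2] b c //=; rewrite !(XmulE Xm). Qed.

(** Treats a mark in [l] and a mark at the root together: in both cases x attaches the right
    subtree. *)
Definition trunk l i := if (i < bsize l)%N then lmul opt l i else lmul opy l 0.

Lemma ev_nf_trunk l r i : (i <= bsize l)%N ->
  e (BNode l r) i = rmul opx (trunk l i) r 0.
Proof.
rewrite ev_nf /trunk leq_eqVlt => /predU1P[->|->] //.
by rewrite ltnn eqxx.
Qed.

Lemma ev_nf_right l r j :
  e (BNode l r) ((bsize l).+1 + j) = rmul opz (lmul opy l 0) r j.
Proof. by rewrite ev_nf addKn; case: ifP; [lia|case: ifP => //; lia]. Qed.

Lemma span_trunk l i k b : (i <= bsize l)%N -> S k b ->
  S (bsize l + k).+1 (trunk l i `x b).
Proof.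
move=> il; move: b; apply: (zspan_map (mullB opx _)) => _ [T [j [Tk jk ->]]].
apply: zspan_gen; exists (BNode l T), i; split; [by rewrite /= Tk|lia|].
have T0 : (0 < bsize T)%N by lia.
have [_ _ -> _] := nf_indep j 0 (trunk l i) T0.
by rewrite ev_nf_trunk //; case: T {Tk} T0.
Qed.

Lemma span_right l k b : S k b -> S (bsize l + k).+1 (lmul opy l 0 `z b).
Proof.
move: b; apply: (zspan_map (mullB opz _)) => _ [T [j [Tk jk ->]]].
apply: zspan_gen; exists (BNode l T), ((bsize l).+1 + j)%N.
split; [by rewrite /= Tk|lia|rewrite ev_nf_right].
by case: T Tk => [|T1 T2] //= Tk; lia.
Qed.

Let sub_comp (f g : A -> A) : {morph f : b c / b - c} ->
  {morph g : b c / b - c} -> {morph f \o g : b c / b - c}.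
Proof. by move=> fB gB b c; rewrite /= gB fB. Qed.

Lemma span_left_t r k b : S k b -> S (k + bsize r).+1 (rmul opx (b `t a) r 0).
Proof.
move: b; apply: (zspan_map (sub_comp (rmulB opx r 0) (mulrB opt a))).
move=> _ [T [j [Tk jk ->]]].
apply: zspan_gen; exists (BNode T r), j; split; [by rewrite /= Tk|lia|].
rewrite ev_nf_trunk /trunk Tk ?jk //=; last lia.
by case: T Tk => [|T1 T2] //= Tk; lia.
Qed.

Lemma span_left_y r k b : S k b -> S (k + bsize r).+1 (rmul opx (b `y a) r 0).
Proof.
move: b; apply: (zspan_map (sub_comp (rmulB opx r 0) (mulrB opy a))).
move=> _ [T [j [Tk jk ->]]].
apply: zspan_gen; exists (BNode T r), k; split; [by rewrite /= Tk|lia|].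
have T0 : (0 < bsize T)%N by lia.
have [_ ya _ _] := nf_indep j 0 a T0.
rewrite ev_nf_trunk /trunk Tk ?ltnn /= ?ya //.
by case: T Tk {T0 ya} => [|T1 T2] //= Tk; lia.
Qed.

Lemma span_left_z r k j b : (j < bsize r)%N -> S k b ->
  S (k + bsize r).+1 (b `y a `z e r j).
Proof.
move=> jr; move: b; apply: (zspan_map (sub_comp (mulrB opz _) (mulrB opy a))).
move=> _ [T [i [Tk ik ->]]].
apply: zspan_gen; exists (BNode T r), ((bsize T).+1 + j)%N.
split; [by rewrite /= Tk|lia|rewrite ev_nf_right].
have T0 : (0 < bsize T)%N by lia.
have [_ ya _ _] := nf_indep i 0 a T0.
rewrite /= ya; case: T Tk T0 {ya} => [|T1 T2] // _ _.
by case: r jr.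
Qed.

(** Follows the recursion of the dendriform product: x and z keep the left part of [T] and multiply
    its right subtree by [U]; y and t keep the right part of [U] and multiply [T] by its left
    subtree. *)
Lemma nf_mul n T U i j o : (bsize T + bsize U = n)%N ->
  (i < bsize T)%N -> (j < bsize U)%N -> S n (m o (e T i) (e U j)).
Proof.
elim/ltn_ind: n T U i j o => n IHn T U i j o defn iT jU.
have Uj k : (k < bsize U)%N -> S (bsize U) (e U k).
  by move=> kU; apply: zspan_gen; exists U, k.
have Ti k : (k < bsize T)%N -> S (bsize T) (e T k).
  by move=> kT; apply: zspan_gen; exists T, k.
case: o.
- case: T iT IHn defn {Ti} => // l r iT IHn defn.
  have IHr k o : (k < bsize r)%N -> S (bsize r + bsize U) (m o (e r k) (e U j)).
    by move=> kr; apply: IHn => //; rewrite -defn /=; lia.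
  case: (leqP i (bsize l)) => il.
    rewrite ev_nf_trunk //.
    have -> : n = (bsize l + (bsize r + bsize U)).+1 by rewrite -defn /=; lia.
    case: r iT IHn defn IHr => [|r1 r2] iT IHn defn IHr;
      rewrite [rmul _ _ _ _]/=.
      by apply: span_trunk => //; apply: Uj.
    rewrite (law1 Xm) -(XmulDr Xm); apply: span_trunk => //.
    by apply: zspan_add; apply: IHr.
  have := ev_nf_right l r (i - (bsize l).+1); rewrite subnKC // => ->.
  have -> : n = (bsize l + (bsize r + bsize U)).+1 by rewrite -defn /=; lia.
  case: r iT IHn defn IHr il => [|r1 r2] iT IHn defn IHr il.
    by move: iT => /=; lia.
  rewrite [rmul _ _ _ _]/=.
  rewrite (law3 Xm) -(XmulDr Xm); apply: span_right => //.
  by apply: zspan_add; apply: IHr; move: iT => /=; lia.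
- case: U jU IHn defn {Uj} => // l r jU IHn defn.
  have -> : n = (bsize T + bsize l + bsize r).+1 by rewrite -defn /=; lia.
  have IHl k o : (k < bsize l)%N -> S (bsize T + bsize l) (m o (e T i) (e l k)).
    by move=> kl; apply: IHn => //; rewrite -defn /=; lia.
  have [b Sb bE] : exists2 b, S (bsize T + bsize l) b &
      e T i `y lmul opy l 0 = b `y a.
    case: l jU IHn defn IHl => [|l1 l2] jU IHn defn IHl.
      by exists (e T i) => //; rewrite addn0; apply: Ti.
    exists (e T i `z e (BNode l1 l2) 0 + e T i `y e (BNode l1 l2) 0).
      by apply: zspan_add; apply: IHl.
    by rewrite (XmulDl Xm) (law15 Xm).
  case: (leqP j (bsize l)) => jl; last first.
    have := ev_nf_right l r (j - (bsize l).+1); rewrite subnKC // => ->.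
    have jr : (j - (bsize l).+1 < bsize r)%N by move: jU => /=; lia.
    have -> c : e T i `y rmul opz c r (j - (bsize l).+1) =
        e T i `y c `z e r (j - (bsize l).+1).
      by case: r jr {jU IHn defn} => [//|r1 r2] _; rewrite (law10 Xm).
    by rewrite bE; apply: span_left_z.
  have yr c : e T i `y rmul opx c r 0 = rmul opx (e T i `y c) r 0.
    by case: r {jU IHn defn} => [//|r1 r2]; rewrite [LHS]/= -(law8 Xm).
  rewrite ev_nf_trunk // yr /trunk; case: ifP => jl'; last first.
    by rewrite bE; apply: span_left_y.
  case: l jl' IHl {jU IHn defn Sb bE jl} => [//|l1 l2] jl' IHl.
  rewrite -(law13 Xm) -(XmulDl Xm); apply: span_left_t.
  by apply: zspan_add; apply: IHl.
- case: T iT IHn defn {Ti} => // l r iT IHn defn.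
  have -> : n = (bsize l + (bsize r + bsize U)).+1 by rewrite -defn /=; lia.
  have IHr k o : (k < bsize r)%N -> S (bsize r + bsize U) (m o (e r k) (e U j)).
    by move=> kr; apply: IHn => //; rewrite -defn /=; lia.
  (* z forgets the mark of [T]. It is moved to the first vertex of [r], making the root product z as
     [law5] requires, or to the root when [r] is empty. *)
  have [-> _ _ _] := nf_indep i (if r is BLeaf then bsize l else (bsize l).+1)
    (e U j) (isT : 0 < bsize (BNode l r))%N.
  case: r iT IHn defn IHr => [|r1 r2] iT IHn defn IHr.
    rewrite ev_nf ltnn eqxx; apply: span_right; exact: Uj.
  rewrite -[(bsize l).+1]addn0 ev_nf_right [rmul _ _ _ _]/=.
  rewrite (law5 Xm) -(XmulDr Xm); apply: span_right.
  by apply: zspan_add; apply: IHr.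
- case: U jU IHn defn {Uj} => // l r jU IHn defn.
  have -> : n = (bsize T + bsize l + bsize r).+1 by rewrite -defn /=; lia.
  have IHl k o : (k < bsize l)%N -> S (bsize T + bsize l) (m o (e T i) (e l k)).
    by move=> kl; apply: IHn => //; rewrite -defn /=; lia.
  (* t forgets the mark of [U]. With the root marked, the left subtree is attached by y and the
     right one by x, as [law12] and [law6] require. *)
  have [_ _ _ ->] := nf_indep j (bsize l) (e T i)
    (isT : 0 < bsize (BNode l r))%N.
  rewrite ev_nf ltnn eqxx.
  have -> c : e T i `t rmul opx c r 0 = rmul opx (e T i `t c) r 0.
    by case: r {jU IHn defn} => [//|r1 r2]; rewrite [LHS]/= -(law6 Xm).
  case: l jU IHn defn IHl => [|l1 l2] jU IHn defn IHl.
    by rewrite addn0; apply: span_left_t; apply: Ti.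
  rewrite [lmul _ _ _]/= -(law12 Xm) -(XmulDl Xm); apply: span_left_t.
  by apply: zspan_add; apply: IHl.
Qed.

Lemma tree_span t : S (leaves t) (ev m (fun=> a) t).
Proof.
elim: t => [|o l IHl r IHr].
  by apply: zspan_gen; exists (BNode BLeaf BLeaf), 0%N.
rewrite [ev _ _ _]/= [leaves _]/=; move: (ev m _ r) IHr => b.
have mB := mullB o (ev m (fun=> a) l).
apply: (zspan_map mB) => _ [U [j [Un jn ->]]].
move: (ev m _ l) IHl {mB} => c; apply: (zspan_map (mulrB o _)).
by move=> _ [T [i [Tn iN ->]]]; rewrite -Tn -Un; apply: nf_mul; rewrite ?Tn ?Un.
Qed.
End Spanning.

(** * The two models *)

Section DendriformModel.
Implicit Types f g h : bt -> rat^o.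

(* The product of the free dendriform algebra on one generator (with a unit),
   computed on coefficient functions: no formal sums of trees are needed, since
   the coefficient of V in f * g is found by recursion on V. *)
Fixpoint star f g (V : bt) : rat :=
  if V is BNode l r then
    star (fun s => f (BNode l s)) g r + star f (fun s => g (BNode s r)) l
  else f BLeaf * g BLeaf.

Lemma starDl f f' g V :
  star (fun s => f s + f' s) g V = star f g V + star f' g V.
Proof.
elim: V f f' g => [|l IHl r IHr] f f' g /=; first by rewrite mulrDl.
by rewrite IHl (IHr (fun s => f (BNode l s))) addrACA.
Qed.

Lemma starDr f g g' V :
  star f (fun s => g s + g' s) V = star f g V + star f g' V.
Proof.
elim: V f g g' => [|l IHl r IHr] f g g' /=; first by rewrite mulrDr.
by rewrite IHr (IHl _ (fun s => g (BNode s r))) addrACA.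
Qed.

Lemma starZl c f g V : star (fun s => c * f s) g V = c * star f g V.
Proof.
elim: V f g => [|l IHl r IHr] f g /=; first by rewrite mulrA.
by rewrite IHl (IHr (fun s => f (BNode l s))) mulrDr.
Qed.

Lemma starZr c f g V : star f (fun s => c * g s) V = c * star f g V.
Proof.
elim: V f g => [|l IHl r IHr] f g /=; first by rewrite mulrCA.
by rewrite IHr (IHl _ (fun s => g (BNode s r))) mulrDr.
Qed.

(** A Fubini rule: [f] is convolved with the first variable of [G] and [h] with the second,
    independently. It carries both associativity and the mixed dendriform axiom. *)
Lemma star_exchange f h (G : bt -> bt -> rat) V W :
  star (fun s => star f (fun s' => G s' s) V) h W =
  star f (fun s' => star (G s') h W) V.
Proof.
elim: W G h => [|l IHl r IHr] G h /=.
  by rewrite mulrC -starZr; congr star; apply/funext => s; rewrite mulrC.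
by rewrite IHl (IHr (fun s' s => G s' (BNode l s))) -starDr.
Qed.

Lemma starA f g h V : star (star f g) h V = star f (star g h) V.
Proof.
elim: V f g h => [|l IHl r IHr] f g h /=; first by rewrite mulrA.
rewrite starDl starDr IHl IHr.
by rewrite (star_exchange f h (fun s' s => g (BNode s' s))) addrA.
Qed.

Lemma star1l c g V : star (fun s => c * (s == BLeaf)%:R) g V = c * g V.
Proof.
rewrite starZl; congr (c * _).
elim: V g => [|l IHl r IHr] g /=; first by rewrite mul1r.
rewrite IHl -[X in X + _]/(star (fun s => 0) g r).
suff -> : star (fun=> 0) g r = 0 by rewrite add0r.
rewrite -[RHS](mul0r (star g g r)) -starZl; congr star.
by apply/funext => s; rewrite mul0r.
Qed.

Lemma star1r c f V : star f (fun s => c * (s == BLeaf)%:R) V = c * f V.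
Proof.
rewrite starZr; congr (c * _).
elim: V f => [|l IHl r IHr] f /=; first by rewrite mulr1.
rewrite IHr -[X in _ + X]/(star f (fun s => 0) l).
suff -> : star f (fun=> 0) l = 0 by rewrite addr0.
rewrite -[RHS](mul0r (star f f l)) -starZr; congr star.
by apply/funext => s; rewrite mul0r.
Qed.

(* The unit is split between the two half-products only outside the augmentation
   ideal, so the coefficient of the empty tree is discarded. *)
Definition reduced f : bt -> rat^o := fun T =>
  if T is BNode _ _ then f T else 0.

Definition prec f g : bt -> rat^o := fun V =>
  if V is BNode l r then star (fun s => f (BNode l s)) (reduced g) r else 0.
Definition succ f g : bt -> rat^o := fun V =>
  if V is BNode l r then star (reduced f) (fun s => g (BNode s r)) l else 0.

Lemma reduced_prec_succ f g :
  reduced (prec f g + succ f g) = star (reduced f) (reduced g).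
Proof. by apply/funext => -[|l r] //=; rewrite mul0r. Qed.

(** First of the three dendriform axioms; the outer two are associativity of [star] on one branch
    below the root. *)
Lemma prec_prec f g h : prec (prec f g) h = prec f (prec g h + succ g h).
Proof. by apply/funext => -[|l r] //=; rewrite reduced_prec_succ -starA. Qed.

Lemma prec_succ f g h : prec (succ f g) h = succ f (prec g h).
Proof.
apply/funext => -[|l r] //=.
exact: (star_exchange (reduced f) (reduced h) (fun s' s => g (BNode s' s))).
Qed.

Lemma succ_succ f g h : succ (prec f g + succ f g) h = succ f (succ g h).
Proof. by apply/funext => -[|l r] //=; rewrite reduced_prec_succ starA. Qed.

Lemma reducedD f g : reduced (f + g) = (fun s => reduced f s + reduced g s).
Proof. by apply/funext => -[|l r] //=; rewrite addr0. Qed.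
Lemma reducedZ c f : reduced (c *: f) = (fun s => c * reduced f s).
Proof. by apply/funext => -[|l r] //=; rewrite mulr0. Qed.

Lemma precDl f f' g : prec (f + f') g = prec f g + prec f' g.
Proof. by apply/funext => -[|l r]; [rewrite -[LHS]addr0|apply: starDl]. Qed.
Lemma precDr f g g' : prec f (g + g') = prec f g + prec f g'.
Proof.
apply/funext => -[|l r]; first by rewrite -[LHS]addr0.
by rewrite /= reducedD; apply: starDr.
Qed.
Lemma succDl f f' g : succ (f + f') g = succ f g + succ f' g.
Proof.
apply/funext => -[|l r]; first by rewrite -[LHS]addr0.
by rewrite /= reducedD; apply: starDl.
Qed.
Lemma succDr f g g' : succ f (g + g') = succ f g + succ f g'.
Proof. by apply/funext => -[|l r]; [rewrite -[LHS]addr0|apply: starDr]. Qed.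
Lemma precZl c f g : prec (c *: f) g = c *: prec f g.
Proof. by apply/funext => -[|l r]; [rewrite -[LHS](mulr0 c)|apply: starZl]. Qed.
Lemma precZr c f g : prec f (c *: g) = c *: prec f g.
Proof.
apply/funext => -[|l r]; first by rewrite -[LHS](mulr0 c).
by rewrite /= reducedZ; apply: starZr.
Qed.
Lemma succZl c f g : succ (c *: f) g = c *: succ f g.
Proof.
apply/funext => -[|l r]; first by rewrite -[LHS](mulr0 c).
by rewrite /= reducedZ; apply: starZl.
Qed.
Lemma succZr c f g : succ f (c *: g) = c *: succ f g.
Proof. by apply/funext => -[|l r]; [rewrite -[LHS](mulr0 c)|apply: starZr]. Qed.

Lemma bt_nodeE l r l' r' : (BNode l r == BNode l' r') = (l == l') && (r == r').
Proof. by apply/eqP/andP => [[-> ->]|[/eqP -> /eqP ->]]. Qed.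

Definition btdelta (T : bt) : bt -> rat^o := fun V => (V == T)%:R.

(** The empty right subtree of [BNode l BLeaf] acts as the unit of [star], so the product only fills
    that place with [T]. *)
Lemma prec_delta l T : (0 < bsize T)%N ->
  prec (btdelta (BNode l BLeaf)) (btdelta T) = btdelta (BNode l T).
Proof.
move=> T0; apply/funext => -[//|l' r'] /=.
have -> : (fun s => btdelta (BNode l BLeaf) (BNode l' s)) =
    fun s => (l' == l)%:R * (s == BLeaf)%:R.
  by apply/funext => s; rewrite /btdelta bt_nodeE -natrM mulnb.
rewrite star1l /btdelta bt_nodeE -mulnb natrM; congr (_ * _).
by case: r' => [|//]; case: T T0.
Qed.

Lemma succ_delta T r : (0 < bsize T)%N ->
  succ (btdelta T) (btdelta (BNode BLeaf r)) = btdelta (BNode T r).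
Proof.
move=> T0; apply/funext => -[//|l' r'] /=.
have -> : (fun s => btdelta (BNode BLeaf r) (BNode s r')) =
    fun s => (r' == r)%:R * (s == BLeaf)%:R.
  by apply/funext => s; rewrite /btdelta bt_nodeE -natrM mulnb andbC.
rewrite star1r /btdelta bt_nodeE -mulnb natrM mulrC; congr (_ * _).
by case: l' => [|//]; case: T T0.
Qed.

End DendriformModel.

Section DendDiasModel.
(* Dias is modelled by polynomials in u and v: the word of length n pointed at i
   is u^(i+1) v^(n-i-1), and a product pointing into one factor evaluates the
   other one on the diagonal. *)
Definition pointed := rat -> rat -> bt -> rat^o.

Definition dd_mul (o : op) (F G : pointed) : pointed := fun u v =>
  match o with
  | opx => prec (F u v) (G v v)
  | opt => succ (F u v) (G v v)
  | opz => prec (F u u) (G u v)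
  | opy => succ (F u u) (G u v)
  end.

Lemma dd_mulDl o F F' G : dd_mul o (F + F') G = dd_mul o F G + dd_mul o F' G.
Proof.
by case: o; apply/funext => u; apply/funext => v;
  (apply: precDl || apply: succDl).
Qed.
Lemma dd_mulDr o F G G' : dd_mul o F (G + G') = dd_mul o F G + dd_mul o F G'.
Proof.
by case: o; apply/funext => u; apply/funext => v;
  (apply: precDr || apply: succDr).
Qed.
Lemma dd_mulZl o c F G : dd_mul o (c *: F) G = c *: dd_mul o F G.
Proof.
by case: o; apply/funext => u; apply/funext => v;
  (apply: precZl || apply: succZl).
Qed.
Lemma dd_mulZr o c F G : dd_mul o F (c *: G) = c *: dd_mul o F G.
Proof.
by case: o; apply/funext => u; apply/funext => v;
  (apply: precZr || apply: succZr).
Qed.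

Lemma dd_laws : Xlaws dd_mul.
Proof.
split; first exact: dd_mulDl; first exact: dd_mulDr; move=> F G H;
  apply/funext => u; apply/funext => v.
- by rewrite /= prec_prec precDr.
- by rewrite /= prec_prec precDr addrC.
- by rewrite /= prec_prec precDr.
- by rewrite /= prec_prec precDr.
- by rewrite /= prec_prec precDr.
- exact: prec_succ.
- exact: prec_succ.
- exact: prec_succ.
- exact: prec_succ.
- exact: prec_succ.
- by rewrite /= -succ_succ succDl.
- by rewrite /= -succ_succ succDl.
- by rewrite /= -succ_succ succDl.
- by rewrite /= -succ_succ succDl.
- by rewrite /= -succ_succ succDl.
(* On the diagonal x coincides with z and t with y, so both sides of [law16] vanish. *)
- by rewrite !addrN.
Qed.

Definition dd_gen : pointed := fun u _ => u *: btdelta (BNode BLeaf BLeaf).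

Lemma dd_defect0 F G H : defect dd_mul F G H = 0.
Proof. by rewrite /defect /diff_ty (XmulDl dd_laws) (XmulNl dd_laws) addrN. Qed.

(** Each normal form becomes one monomial times one basis tree, so independence needs no
    triangularity argument. *)
Lemma dd_nf T i : (i < bsize T)%N ->
  ev dd_mul (fun=> dd_gen) (nf T i) =
  fun u v => (u ^+ i.+1 * v ^+ (bsize T - i.+1)) *: btdelta T.
Proof.
elim: T i => [//|l IHl r IHr] i il.
have nf0 T : (forall i, (i < bsize T)%N -> ev dd_mul (fun=> dd_gen) (nf T i) =
  fun u v => (u ^+ i.+1 * v ^+ (bsize T - i.+1)) *: btdelta T) ->
  (0 < bsize T)%N ->
  forall v, ev dd_mul (fun=> dd_gen) (nf T 0) v v = v ^+ bsize T *: btdelta T.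
  by move=> IH T0 v; rewrite IH // -exprD subnKC.
have right_x (F : pointed) c u v : F u v = c *: btdelta (BNode l BLeaf) ->
  rmul dd_mul dd_gen opx F r 0 u v = (c * v ^+ bsize r) *: btdelta (BNode l r).
  case: r IHr {il} => [|r1 r2] IHr /= FE; first by rewrite FE mulr1.
  by rewrite FE nf0 // precZl precZr prec_delta // scalerA.
have left_y u v : lmul dd_mul dd_gen opy l 0 u v =
    u ^+ (bsize l).+1 *: btdelta (BNode l BLeaf).
  case: l IHl {right_x il} => [|l1 l2] IHl; first by rewrite expr1.
  by rewrite /= nf0 // succZl succZr succ_delta // scalerA -exprSr.
rewrite ev_nf; case: ifP => il'; last case: ifP => [/eqP -> | il''].
- apply/funext => u; apply/funext => v.
  rewrite (right_x _ (u ^+ i.+1 * v ^+ (bsize l - i.+1) * v)).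
    congr (_ *: _); rewrite -!mulrA -exprS -exprD.
    by congr (_ * _ ^+ _) => /=; lia.
  case: l IHl il' {right_x left_y il} => [//|l1 l2] IHl il'.
  by rewrite /= IHl // succZl succZr succ_delta // scalerA.
- apply/funext => u; apply/funext => v.
  rewrite (right_x _ (u ^+ (bsize l).+1)).
    have -> // : (bsize (BNode l r) - (bsize l).+1 = bsize r)%N.
    by rewrite /=; lia.
  exact: left_y.
apply/funext => u; apply/funext => v.
have [j -> jr] : exists2 j, i = ((bsize l).+1 + j)%N & (j < bsize r)%N.
  by exists (i - (bsize l).+1)%N; move: il => /=; lia.
rewrite addKn; case: r IHr jr {right_x il} => [//|r1 r2] IHr jr.
rewrite [LHS]/= left_y IHr // precZl precZr prec_delta // scalerA mulrA -exprD.
congr (_ *: _); congr (_ ^+ _ * _ ^+ _) => /=; lia.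
Qed.
End DendDiasModel.

Definition xy_mul (o : op) (a b : rat^o) : rat^o :=
  if is_xy o then a * b else 0.

Lemma xy_laws : Xlaws xy_mul.
Proof.
split=> [o a b c|o a b c|a b c|a b c|a b c|a b c|a b c|a b c|a b c|a b c|a b c
  |a b c|a b c|a b c|a b c|a b c|a b c|a b c]; rewrite /xy_mul /=;
  try (by case: is_xy; rewrite ?addr0 ?mulrDl ?mulrDr);
  by rewrite ?(mul0r, mulr0, addr0, add0r, oppr0, sub0r) ?mulrA.
Qed.

Lemma xy_defect a b c : defect xy_mul a b c = - (a * b * c).
Proof. by rewrite /defect /diff_ty /xy_mul /= sub0r mulNr. Qed.

(** * Counting *)

Definition join_forest (s : seq bt) : seq bt :=
  if s is l :: r :: s' then BNode l r :: s' else s.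

(* [forests n k] lists the forests of k trees with n vertices, split
   according to whether the first tree is empty, so that their number obeys
   the ballot recurrence. *)
Fixpoint forests (n : nat) : nat -> seq (seq bt) :=
  if n is n'.+1 then
    fix aux k := if k is k'.+1 then
        map (cons BLeaf) (aux k') ++ map join_forest (forests n' k'.+2)
      else [::]
  else fun k => [:: nseq k BLeaf].

Lemma forestsS n k : forests n.+1 k.+1 =
  map (cons BLeaf) (forests n.+1 k) ++ map join_forest (forests n k.+2).
Proof. by []. Qed.

Lemma mem_forests n s : sumn (map bsize s) = n -> s \in forests n (size s).
Proof.
elim/ltn_ind: n s => n IHn; elim=> [<- //|[|l r] s IHs] sn.
  case: n IHn IHs sn => [|n] IHn IHs sn.
    by have := IHs sn; rewrite !inE => /eqP {1}->.
  rewrite forestsS mem_cat; apply/orP; left; apply/mapP; exists s => //.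
  exact: IHs.
case: n IHn IHs sn => [//|n] IHn IHs sn.
rewrite [size _]/= forestsS mem_cat; apply/orP; right; apply/mapP.
exists [:: l, r & s] => //; apply: (IHn n _ [:: l, r & s]) => //.
by move: sn => /=; lia.
Qed.

Lemma forestsP n k s :
  reflect (size s = k /\ sumn (map bsize s) = n) (s \in forests n k).
Proof.
apply: (iffP idP).
  elim: n k s => [|n IHn] k s.
    by rewrite inE => /eqP ->; rewrite size_nseq map_nseq sumn_nseq.
  elim: k s => [//|k IHk] s.
  rewrite forestsS mem_cat => /orP[] /mapP[s' s'in ->].
    by have [<- <-] := IHk _ s'in.
  have := IHn _ _ s'in.
  by case: s' {s'in} => [|l [|r s']] [] //= [<-] <-; split; lia.
by move=> [<- <-]; apply: mem_forests.
Qed.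

Lemma forests_uniq n k : uniq (forests n k).
Proof.
elim: n k => [//|n IHn] k; elim: k => [//|k IHk].
rewrite forestsS cat_uniq map_inj_uniq ?IHk ?map_inj_in_uniq ?IHn ?andbT //=.
- apply/hasPn => _ /mapP[s /forestsP[sz _] ->]; apply/mapP => -[s' _].
  by case: s sz => [|l [|r s]].
- move=> s s' /forestsP[sz _] /forestsP[sz' _].
  case: s sz => [|l [|r s]] // _.
  by case: s' sz' => [|l' [|r' s']] // _ [-> -> ->].
- by move=> s s' [].
Qed.

(** Ballot numbers as differences of binomials, written without subtraction. The recurrence
    [forestsS] matches Pascal's rule; its boundary k = 0 uses the symmetry of the two middle
    binomials. *)
Lemma size_forests n k :
  (size (forests n.+1 k.+1) + 'C(2 * n.+1 + k, n) = 'C(2 * n.+1 + k, n.+1))%N.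
Proof.
elim: n k => [|n IHn] k.
  have -> : size (forests 1 k.+1) = k.+1.
    by elim: k => [//|k IHk]; rewrite forestsS size_cat !size_map IHk addn1.
  by rewrite bin0 bin1; lia.
elim: k => [|k IHk]; rewrite forestsS size_cat !size_map.
  have := IHn 1%N; rewrite (_ : 2 * n.+2 + 0 = (2 * n.+1 + 1).+1)%N; last lia.
  have sym : ('C(2 * n.+1 + 1, n.+2) = 'C(2 * n.+1 + 1, n.+1))%N.
    by rewrite -[RHS]bin_sub; [congr 'C(_, _); lia|lia].
  by rewrite !(binS (2 * n.+1 + 1)) sym [size (forests _ 0)]/=; lia.
have := IHn k.+2; move: IHk.
rewrite (_ : 2 * n.+2 + k = 2 * n.+1 + k.+2)%N; last lia.
rewrite (_ : 2 * n.+2 + k.+1 = (2 * n.+1 + k.+2).+1)%N; last lia.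
by rewrite !(binS (2 * n.+1 + k.+2)); lia.
Qed.

Definition nf_indices (n : nat) : seq (bt * nat) :=
  [seq (T, i) | T <- map (head BLeaf) (forests n 1), i <- iota 0 n].

Lemma nf_indicesP n T i :
  reflect (bsize T = n /\ (i < n)%N) ((T, i) \in nf_indices n).
Proof.
apply: (iffP allpairsP) => [[[T' i'] []]|[Tn il]].
  move=> /= /mapP[s /forestsP[sz sn] ->].
  rewrite mem_iota => i'n [-> ->]; split=> //.
  by case: s sz sn => [|T0 [|]] //= _; rewrite addn0.
exists (T, i); rewrite mem_iota; split=> //=; apply/mapP; exists [:: T] => //.
by apply/forestsP; rewrite /= addn0.
Qed.

Lemma nf_indices_uniq n : uniq (nf_indices n).
Proof.
apply: allpairs_uniq; rewrite ?iota_uniq //.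
  rewrite map_inj_in_uniq ?forests_uniq //.
  move=> s s' /forestsP[sz _] /forestsP[sz' _].
  by case: s sz => [|T []] //; case: s' sz' => [|T' []] // _ _ /= ->.
by move=> [T i] [T' i'] _ _ [-> ->].
Qed.

Lemma size_nf_indices n : (0 < n)%N -> size (nf_indices n) = 'C(2 * n, n - 1).
Proof.
rewrite size_allpairs size_map size_iota; case: n => [//|n] _.
have := size_forests n 0; rewrite addn0 subn1 /= => sz.
(* With N = n + 1 this reads N C(2N, N) = (N + 1) C(2N, N - 1), which turns N (C(2N, N) - C(2N, N -
   1)) into C(2N, N - 1). *)
have := mul_bin_left (2 * n.+1) n; nia.
Qed.

(** * Evaluation of the free operad *)

Section TreeFunctional.
Variables (C : lmodType rat) (phi : tree -> C).

Definition lin_tree n (f : freeop rat n) : C :=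
  \sum_(t : ntree n) f t *: phi (val t).

Fact lin_tree_is_linear n : linear (@lin_tree n).
Proof.
move=> c f g; rewrite /lin_tree scaler_sumr -big_split; apply: eq_bigr => t _.
by rewrite !ffunE scalerDl scalerA.
Qed.
HB.instance Definition _ n :=
  GRing.isLinear.Build rat (freeop rat n) C *:%R (@lin_tree n)
    (@lin_tree_is_linear n).

Lemma lin_tree_vec n (t : ntree n) : lin_tree (tree_vec rat t) = phi (val t).
Proof.
rewrite /lin_tree (bigD1 t) //= ffunE eqxx scale1r.
rewrite big1 ?addr0 // => s /negbTE st.
by rewrite ffunE st scale0r.
Qed.

Lemma lin_tree_ocomp k n (f : freeop rat k) (i : 'I_k) (g : freeop rat n) :
  lin_tree (ocomp f i g) =
  \sum_(t : ntree k) \sum_(s : ntree n)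
     (f t * g s) *: phi (graft (val t) i (val s)).
Proof.
rewrite /ocomp raddf_sum; apply: eq_bigr => t _.
rewrite raddf_sum; apply: eq_bigr => s _.
by rewrite /= linearZ /= lin_tree_vec.
Qed.

End TreeFunctional.
Arguments lin_tree {C} phi {n} f.

Lemma lin_tree_ocomp_vec (C : lmodType rat) (phi : tree -> C) k n
    (f : freeop rat k) (i : 'I_k) (s : ntree n) :
  lin_tree phi (ocomp f i (tree_vec rat s)) =
  lin_tree (fun t => phi (graft t i (val s))) f.
Proof.
rewrite lin_tree_ocomp; apply: eq_bigr => t _.
rewrite (bigD1 s) //= ffunE eqxx mulr1 big1 ?addr0 // => s' /negbTE ss'.
by rewrite ffunE ss' mulr0 scale0r.
Qed.

Lemma lin_tree_vec_ocomp (C : lmodType rat) (phi : tree -> C) k n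
    (t : ntree k) (i : 'I_k) (g : freeop rat n) :
  lin_tree phi (ocomp (tree_vec rat t) i g) =
  lin_tree (fun s => phi (graft (val t) i s)) g.
Proof.
rewrite lin_tree_ocomp (bigD1 t) //= [X in _ + X]big1 ?addr0 => [|s /negbTE st].
  by apply: eq_bigr => s _; rewrite ffunE eqxx mul1r.
by rewrite big1 // => s' _; rewrite ffunE st mul0r scale0r.
Qed.

Section Evaluation.
Variables (C : lmodType rat) (m : op -> C -> C -> C).
Hypothesis mDl : forall o a b c, m o (a + b) c = m o a c + m o b c.
Hypothesis mDr : forall o a b c, m o a (b + c) = m o a b + m o a c.
Hypothesis mZl : forall o k a b, m o (k *: a) b = k *: m o a b.
Hypothesis mZr : forall o k a b, m o a (k *: b) = k *: m o a b.
Local Notation eval rho := (lin_tree (ev m rho)).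

Lemma eval_relations rho : map (eval rho) (relations 1) =
  Xdefects m (rho 0%N) (rho 1%N) (rho 2%N).
Proof.
have lcE o p : eval rho (lc rat o p) = m o (m p (rho 0%N) (rho 1%N)) (rho 2%N).
  by rewrite /lc lin_tree_vec.
have rcE o p : eval rho (rc rat o p) = m o (rho 0%N) (m p (rho 1%N) (rho 2%N)).
  by rewrite /rc lin_tree_vec.
have subE (f g : freeop rat 3) : eval rho (f - g) = eval rho f - eval rho g.
  exact: raddfB.
have addE (f g : freeop rat 3) : eval rho (f + g) = eval rho f + eval rho g.
  exact: raddfD.
rewrite /relations /Xdefects scale1r.
move: (lc rat) (rc rat) lcE rcE => L R lcE rcE; rewrite [LHS]/=.
by rewrite !subE !addE !lcE !rcE.
Qed.

(** The arguments seen by [f] in a composite of [f] and [g] at input [i]: the [n] inputs of [g]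
    count as one, whence the shift by n - 1 beyond [i]. *)
Definition subst_arg (rho : nat -> C) i n (c : C) : nat -> C := fun j =>
  if (j < i)%N then rho j else if j == i then c else rho (j + n).-1.

Lemma ev_ext rho rho' t :
  (forall j, (j < leaves t)%N -> rho j = rho' j) -> ev m rho t = ev m rho' t.
Proof.
elim: t rho rho' => [|o l IHl r IHr] rho rho' eqr /=; first exact: eqr.
congr (m o _ _); [apply: IHl|apply: IHr] => j jl; apply: eqr => /=; lia.
Qed.

Lemma ev_graft rho t i s : (i < leaves t)%N ->
  ev m rho (graft t i s) =
  ev m (subst_arg rho i (leaves s) (ev m (fun j => rho (i + j)%N) s)) t.
Proof.
elim: t rho i => [|o l IHl r IHr] rho i /= it.
  by rewrite /subst_arg; case: i it.
case: ltnP => il /=.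
  rewrite IHl //; congr (m o _ _); apply: ev_ext => j jr.
  have s0 := leaves_gt0 s; rewrite /subst_arg leaves_graft //.
  case: ltnP => [|_]; first lia; case: eqP => [|_]; first lia.
  by congr rho; lia.
congr (m o _ _).
  by apply: ev_ext => j jl; rewrite /subst_arg; case: ltnP => //; lia.
rewrite IHr; last by rewrite ltn_subLR.
apply: ev_ext => j jr; rewrite /subst_arg; have := leaves_gt0 s => s0.
have -> : (j < i - leaves l)%N = (leaves l + j < i)%N by lia.
have -> : (j == i - leaves l)%N = (leaves l + j == i)%N by lia.
case: ltnP => // _; case: eqP => [_|]; last by move=> ?; congr rho; lia.
by congr ev; apply/funext => k; congr rho; lia.
Qed.

Lemma ev_subst_linear rho i n t k c d : (i < leaves t)%N ->
  ev m (subst_arg rho i n (k *: c + d)) t =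
  k *: ev m (subst_arg rho i n c) t + ev m (subst_arg rho i n d) t.
Proof.
elim: t rho i => [|o l IHl r IHr] rho i /= it.
  by rewrite /subst_arg; case: i it.
case: (ltnP i (leaves l)) => il.
  have er c' : ev m (fun j => subst_arg rho i n c' (leaves l + j)) r =
      ev m (fun j => rho (leaves l + j + n).-1) r.
    apply: ev_ext => j _; rewrite /subst_arg; case: ltnP => [|_]; first lia.
    by case: eqP => [|//]; lia.
  by rewrite !er IHl // mDl mZl.
have el c' : ev m (subst_arg rho i n c') l = ev m rho l.
  by apply: ev_ext => j jl; rewrite /subst_arg; case: ltnP => //; lia.
have er c' : (fun j => subst_arg rho i n c' (leaves l + j)%N) =
    subst_arg (fun j => rho (leaves l + j)%N) (i - leaves l) n c'.
  apply/funext => j; rewrite /subst_arg.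
  have -> : (j < i - leaves l)%N = (leaves l + j < i)%N by lia.
  have -> : (j == i - leaves l)%N = (leaves l + j == i)%N by lia.
  case: ltnP => // ij; case: eqP => // ji; congr rho; lia.
by rewrite !el !er IHr ?mDr ?mZr // ltn_subLR.
Qed.

Lemma ev_subst0 rho i n t :
  (i < leaves t)%N -> ev m (subst_arg rho i n 0) t = 0.
Proof.
move=> it; have := ev_subst_linear rho n 1 0 0 it.
by rewrite !scale1r addr0 => /eqP; rewrite -subr_eq subrr eq_sym => /eqP.
Qed.

Lemma eval_ocomp rho k n (f : freeop rat k) (i : 'I_k) (g : freeop rat n) :
  eval rho (ocomp f i g) =
  eval (subst_arg rho i n (eval (fun j => rho (i + j)%N) g)) f.
Proof.
rewrite lin_tree_ocomp; apply: eq_bigr => t _.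
have it : (i < leaves (val t))%N by rewrite (eqP (valP t)).
pose E c := ev m (subst_arg rho i n c) (val t).
have E0 : E 0 = 0 by apply: ev_subst0.
have ED c d : E (c + d) = E c + E d.
  by have := ev_subst_linear rho n 1 c d it; rewrite !scale1r.
have EZ a c : E (a *: c) = a *: E c.
  have := ev_subst_linear rho n a c 0 it.
  by rewrite -/(E _) -/(E _) -/(E _) E0 !addr0.
rewrite -/(E _) /lin_tree (big_morph E ED E0) scaler_sumr.
apply: eq_bigr => s _.
by rewrite EZ scalerA ev_graft // (eqP (valP s)).
Qed.

Lemma eval_gen_ideal rho n (f : freeop rat n) : Xlaws m ->
  f \in gen_ideal (relations 1) n -> eval rho f = 0.
Proof.
move=> Xm /gen_idealP fI.
(* All [rho] are needed at once: a composition changes the arguments of its factors. *)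
pose P k (g : freeop rat k) := forall rho, eval rho g = 0.
have P0 k : @P k 0 by move=> rho'; rewrite raddf0.
have PD k a (g h : freeop rat k) : P k g -> P k h -> P k (a *: g + h).
  by move=> Pg Ph rho'; rewrite linearP /= Pg Ph scaler0 addr0.
pose I k := sval (vspace_of_submod (@P0 k) (@PD k)).
have IP k g : g \in I k <-> P k g := svalP (vspace_of_submod (@P0 k) (@PD k)) g.
suff : f \in I n by move=> /IP; apply.
apply: fI => [k l g i h|r rR]; last first.
  apply/IP => rho'; have := map_f (eval rho') rR.
  by rewrite eval_relations Xdefects0 // mem_nseq => /andP[_ /eqP].
rewrite !IP => gh rho'; rewrite eval_ocomp; case: gh => [-> //|->].
rewrite /lin_tree big1 // => t _; rewrite ev_subst0 ?scaler0 //.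
by rewrite (eqP (valP t)).
Qed.
End Evaluation.

(** * The operadic ideal inside the algebra of functions on trees *)

Lemma gen_ideal_ocomp (R : seq (freeop rat 3)) k n (f : freeop rat k) (i : 'I_k)
    (g : freeop rat n) :
  f \in gen_ideal R k \/ g \in gen_ideal R n ->
  ocomp f i g \in gen_ideal R (k + n).-1.
Proof.
rewrite !gen_idealP => fg I idI RI; apply: (idI).
by case: fg => h; [left|right]; apply: h.
Qed.

Lemma gen_ideal_mem (R : seq (freeop rat 3)) : {subset R <= gen_ideal R 3}.
Proof. by move=> r rR; apply/gen_idealP => I _; apply. Qed.

(** Functions are formal, possibly infinite, sums of trees of all arities. A tree splits uniquely at
    its root, so each coefficient of a product is a single term. *)
Definition tmul (o : op) (f g : tree -> rat^o) : tree -> rat^o := fun t =>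
  if t is Node o' l r then (o' == o)%:R * (f l * g r) else 0.

Lemma tmulDl o f f' g : tmul o (f + f') g = tmul o f g + tmul o f' g.
Proof.
by apply/funext => -[|o' l r]; rewrite !fctE /= ?addr0 // mulrDl mulrDr.
Qed.

Lemma tmulDr o f g g' : tmul o f (g + g') = tmul o f g + tmul o f g'.
Proof.
by apply/funext => -[|o' l r]; rewrite !fctE /= ?addr0 // !mulrDr.
Qed.

Lemma tmulZl o k f g : tmul o (k *: f) g = k *: tmul o f g.
Proof.
apply/funext => -[|o' l r]; first by rewrite -[LHS](mulr0 k).
have e (b x y c : rat) : b * (c * x * y) = c * (b * (x * y)) by ring.
exact: e.
Qed.

Lemma tmulZr o k f g : tmul o f (k *: g) = k *: tmul o f g.
Proof.
apply/funext => -[|o' l r]; first by rewrite -[LHS](mulr0 k).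
have e (b x y c : rat) : b * (x * (c * y)) = c * (b * (x * y)) by ring.
exact: e.
Qed.

Definition tdelta (t : tree) : tree -> rat^o := fun s => (s == t)%:R.

Lemma tree_nodeE o l r o' l' r' :
  (Node o l r == Node o' l' r') = [&& o == o', l == l' & r == r'].
Proof.
by apply/eqP/and3P => [[-> -> ->]|[/eqP -> /eqP -> /eqP ->]].
Qed.

Lemma tmul_delta o l r : tmul o (tdelta l) (tdelta r) = tdelta (Node o l r).
Proof.
apply/funext => -[|o' l' r'] //=.
by rewrite /tdelta tree_nodeE -!mulnb !natrM.
Qed.

Lemma ev_tdelta t : ev tmul (fun=> tdelta Leaf) t = tdelta t.
Proof. by elim: t => //= o l -> r ->; rewrite tmul_delta. Qed.

Lemma tree1P t : leaves t = 1%N -> t = Leaf.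
Proof.
case: t => [//|o l r] /=; have := leaves_gt0 l; have := leaves_gt0 r; lia.
Qed.

Lemma tree2P t : leaves t = 2%N -> exists p, t = Node p Leaf Leaf.
Proof.
case: t => [//|p l r] /= lr.
have l0 := leaves_gt0 l; have r0 := leaves_gt0 r.
have -> : l = Leaf by apply: tree1P; lia.
have -> : r = Leaf by apply: tree1P; lia.
by exists p.
Qed.

Lemma tree3P t : leaves t = 3%N ->
  (exists o p, t = Node o (Node p Leaf Leaf) Leaf) \/
  (exists o p, t = Node o Leaf (Node p Leaf Leaf)).
Proof.
case: t => [//|o l r] /= lr.
have l0 := leaves_gt0 l; have r0 := leaves_gt0 r.
have [l1|l2] : leaves l = 1%N \/ leaves l = 2%N by lia.
  by right; rewrite (tree1P l1); have [|p ->] := @tree2P r; [lia|exists o, p].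
left; have [p ->] := tree2P l2; exists o, p; congr Node; apply: tree1P; lia.
Qed.

Definition arity_part n (f : tree -> rat^o) : freeop rat n :=
  [ffun t : ntree n => f (val t)].

Lemma arity_partB n f g :
  arity_part n (f - g) = arity_part n f - arity_part n g.
Proof. by apply/ffunP => t; rewrite !ffunE. Qed.

Lemma arity_part_delta n (t : ntree n) :
  arity_part n (tdelta (val t)) = tree_vec rat t.
Proof. by apply/ffunP => s; rewrite !ffunE /tdelta (inj_eq val_inj). Qed.

Section IdealOfTrees.
Variable R : seq (freeop rat 3).

Definition tideal (f : tree -> rat^o) : Prop :=
  forall n, arity_part n f \in gen_ideal R n.

Lemma tideal_lin_tree n (f : freeop rat n) : f \in gen_ideal R n ->
  tideal (lin_tree tdelta f).
Proof.
have evalE t : lin_tree tdelta f t = \sum_(s : ntree n) f s * (t == val s)%:R.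
  by rewrite /lin_tree fct_sumE.
move=> fI k; case: (eqVneq k n) => [->|kn].
  suff -> : arity_part n (lin_tree tdelta f) = f by [].
  apply/ffunP => t; rewrite ffunE evalE (bigD1 t) //= eqxx mulr1 big1 ?addr0 //.
  by move=> s st; rewrite (inj_eq val_inj) eq_sym (negbTE st) mulr0.
suff -> : arity_part k (lin_tree tdelta f) = 0 by apply: mem0v.
apply/ffunP => t; rewrite !ffunE evalE big1 // => s _.
case: eqP => [ts|_]; last by rewrite mulr0.
by case/eqP: kn; rewrite -(eqP (valP t)) -(eqP (valP s)) ts.
Qed.

Lemma tideal_relation r u v w : r \in R ->
  tideal (lin_tree
    (ev tmul (fun i => nth 0 [:: tdelta u; tdelta v; tdelta w] i)) r).
Proof.
move=> rR; have rI := gen_ideal_mem rR.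
(* Grafting from the last input to the first leaves the numbers of the remaining inputs
   unchanged. *)
pose e1 := ocomp r (@Ordinal 3 2 isT) (tree_vec rat (exist _ w (eqxx _))).
have lt1 : (1 < (3 + leaves w).-1)%N by rewrite addSn.
pose e2 := ocomp e1 (Ordinal lt1) (tree_vec rat (exist _ v (eqxx _))).
have lt0 : (0 < ((3 + leaves w).-1 + leaves v).-1)%N by rewrite addSn.
pose e3 := ocomp e2 (Ordinal lt0) (tree_vec rat (exist _ u (eqxx _))).
have e3I : e3 \in gen_ideal R _ by do 3! [apply: gen_ideal_ocomp; left].
have := tideal_lin_tree e3I; rewrite !lin_tree_ocomp_vec /=.
suff -> :
    lin_tree (fun t => tdelta (graft (graft (graft t 2 w) 1 v) 0 u)) r =
    lin_tree (ev tmul (fun i => nth 0 [:: tdelta u; tdelta v; tdelta w] i)) r.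
  by [].
apply: eq_bigr => -[t /= t3] _; congr (_ *: _).
by case: (tree3P (eqP t3)) => -[o [p ->]] /=; rewrite !tmul_delta.
Qed.

Lemma tideal_graft t i k f : (i < leaves t)%N -> tideal f ->
  tideal (lin_tree (fun s => tdelta (graft t i s)) (arity_part k f)).
Proof.
move=> it fI.
have := @tideal_lin_tree _ (ocomp (tree_vec rat (exist _ t (eqxx (leaves t))))
  (Ordinal it) (arity_part k f)).
rewrite lin_tree_vec_ocomp; apply; apply: gen_ideal_ocomp; right; exact: fI.
Qed.

Lemma tideal_local n f g : arity_part n f = arity_part n g -> tideal g ->
  arity_part n f \in gen_ideal R n.
Proof. by move=> -> gI; apply: gI. Qed.

Lemma lin_tree_arity_part k phi f t :
  lin_tree (fun s => tdelta (phi s)) (arity_part k f) t =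
  \sum_(s : ntree k) f (val s) * (t == phi (val s))%:R.
Proof.
rewrite /lin_tree fct_sumE; apply: eq_bigr => s _.
by rewrite ffunE !fctE.
Qed.

(** In arity [n] this product is the composite of [Node o Leaf v], at its first input, with the part
    of [f] of arity [n - leaves v]. *)
Lemma tideal_mulr o f v : tideal f -> tideal (tmul o f (tdelta v)).
Proof.
move=> fI n.
have := @tideal_graft (Node o Leaf v) 0 (n - leaves v) f isT fI.
apply: tideal_local; apply/ffunP => t; rewrite !ffunE.
move: (val t) (eqP (valP t)) => {}t tn.
rewrite lin_tree_arity_part /=; case: t tn => [|o' l r] tn /=.
  by rewrite big1 // => s _; rewrite mulr0.
rewrite /tdelta; case: (eqVneq r v) => [rv|rv]; last first.
  by rewrite !mulr0 big1 // => s _; rewrite tree_nodeE (negbTE rv) !andbF mulr0.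
have lk : leaves l == (n - leaves v)%N by rewrite -tn /= rv addnK.
pose s0 : ntree (n - leaves v)%N := exist _ l lk.
rewrite (bigD1 s0) //= tree_nodeE rv !eqxx !andbT mulr1.
rewrite big1 ?addr0 1?mulrC // => s sl; rewrite tree_nodeE.
have /negbTE -> : l != val s.
  by apply: contra sl => /eqP ls; apply/eqP/val_inj; rewrite /= -ls.
by rewrite andbF mulr0.
Qed.

Lemma tideal_mull o u f : tideal f -> tideal (tmul o (tdelta u) f).
Proof.
move=> fI n.
have it : (leaves u < leaves (Node o u Leaf))%N by rewrite /= addn1.
have := @tideal_graft _ _ (n - leaves u) f it fI.
apply: tideal_local; apply/ffunP => t; rewrite !ffunE.
move: (val t) (eqP (valP t)) => {}t tn.
rewrite lin_tree_arity_part /= ltnn; case: t tn => [|o' l r] tn /=.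
  by rewrite big1 // => s _; rewrite mulr0.
rewrite /tdelta; case: (eqVneq l u) => [lu|lu]; last first.
  rewrite mul0r mulr0 big1 // => s _.
  by rewrite tree_nodeE (negbTE lu) andbF mulr0.
have rk : leaves r == (n - leaves u)%N by rewrite -tn /= lu addKn.
pose s0 : ntree (n - leaves u)%N := exist _ r rk.
rewrite (bigD1 s0) //= tree_nodeE lu !eqxx !andbT mul1r.
rewrite big1 ?addr0 1?mulrC // => s sr; rewrite tree_nodeE.
have /negbTE -> : r != val s.
  by apply: contra sr => /eqP rs; apply/eqP/val_inj; rewrite /= -rs.
by rewrite !andbF mulr0.
Qed.
End IdealOfTrees.

Lemma ev_morph (A B : Type) (m : op -> A -> A -> A) (m' : op -> B -> B -> B)
    (f : A -> B) rho t : (forall o a b, f (m o a b) = m' o (f a) (f b)) ->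
  f (ev m rho t) = ev m' (f \o rho) t.
Proof.
by move=> fm; elim: t rho => //= o l IHl r IHr rho; rewrite fm IHl IHr.
Qed.

(** * Spanning sets of algebras generated by one element *)

Section GeneratedAlgebra.
Variables (A : zmodType) (m : op -> A -> A -> A).
Hypothesis Xm : Xlaws m.
Variable a : A.
Local Notation gen := (ev m (fun=> a)).
Hypothesis gen_span : forall b, zspan (fun c => exists t, c = gen t) b.

Let mulr_sub o b c d : m o (c - d) b = m o c b - m o d b.
Proof. by rewrite !(XmulE Xm). Qed.
Let mull_sub o b c d : m o b (c - d) = m o b c - m o b d.
Proof. by rewrite !(XmulE Xm). Qed.

Let word_span := zspan (fun b => exists w, b = word m a w).
Let word_spanB b c : word_span b -> word_span c -> word_span (b - c).
Proof. exact: zspan_sub. Qed.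
Let K := Subgroup (zspan0 _ : word_span 0) word_spanB.

Let K_mulr o b c : K b -> K (m o b c).
Proof.
move=> Kb; have := gen_span c; move: c.
apply: zspan_min => [|c d Kc Kd|_ [t ->]].
- by rewrite (Xmul0r Xm); apply: zspan0.
- by rewrite mull_sub; apply: zspan_sub.
- exact: word_mulr.
Qed.

Let K_mull o b c : K c -> K (m o b c).
Proof.
move=> Kc; have := gen_span b; move: b.
apply: zspan_min => [|b d Kb Kd|_ [t ->]].
- by rewrite (Xmul0l Xm); apply: zspan0.
- by rewrite mulr_sub; apply: zspan_sub.
- exact: word_mull.
Qed.

Let K_defect b c d : K (defect m b c d).
Proof.
have := gen_span b; move: b; apply: zspan_min => [|b b' Kb Kb'|_ [u ->]].
- by rewrite -[0](subrr 0) !(defect_additive Xm) subrr; apply: zspan0.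
- by rewrite !(defect_additive Xm); apply: zspan_sub.
have := gen_span c; move: c; apply: zspan_min => [|c c' Kc Kc'|_ [v ->]].
- by rewrite -[0](subrr 0) !(defect_additive Xm) subrr; apply: zspan0.
- by rewrite !(defect_additive Xm); apply: zspan_sub.
have := gen_span d; move: d; apply: zspan_min => [|d d' Kd Kd'|_ [w ->]].
- by rewrite -[0](subrr 0) !(defect_additive Xm) subrr; apply: zspan0.
- by rewrite !(defect_additive Xm); apply: zspan_sub.
exact: defect_span.
Qed.

(** The defect vanishes modulo the words, so [tree_span] applies to the quotient; lifting back costs
    a combination of words. Their length is not controlled here: projecting to one arity discards
    the wrong ones. *)
Lemma gen_nf_word_span t :
  zspan (fun b => nf_elt m a (leaves t) b \/ exists w, b = word m a w) (gen t).
Proof.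
pose mK := @zquot_mul A K m; pose pi := zpi K.
have mKE o b c : mK o (zpi K b) (zpi K c) = zpi K (m o b c).
  exact: (zquot_mulE (XmulDl Xm) (XmulDr Xm) K_mulr K_mull).
have XK : Xlaws mK.
  apply: (Xlaws_zquot (XmulDl Xm) (XmulDr Xm) K_mulr K_mull) => b c d.
  rewrite Xdefects0 // map_nseq; congr nseq; exact/zpi_eq0/zspan0.
have defect0 b c d : defect mK b c d = 0.
  rewrite -[b]zpi_repr -[c]zpi_repr -[d]zpi_repr /defect /diff_ty.
  by rewrite !mKE -zpiB mKE; apply/zpi_eq0; apply: K_defect.
have piE t' : ev mK (fun=> pi a) t' = pi (gen t').
  by rewrite (@ev_morph _ _ m mK pi) // => o b c; rewrite mKE.
have /(zspan_lift (f := pi)) [b c|b Sb pib] :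
    zspan (fun b => exists2 g, nf_elt m a (leaves t) g & b = pi g) (pi (gen t)).
- rewrite -piE; have := tree_span XK defect0 (pi a) t.
  apply: zspan_min; [exact: zspan0|exact: zspan_sub|].
  move=> _ [T [i [Tt it ->]]]; apply: zspan_gen; exists (gen (nf T i)) => //.
  by exists T, i.
- exact: zpiB.
rewrite -[gen t](subKr b); apply: zspan_sub.
  move: Sb; apply: zspan_min; [exact: zspan0|exact: zspan_sub|].
  by move=> c Sc; apply: zspan_gen; left.
have : K (b - gen t) by apply/zpi_eq.
apply: zspan_min; [exact: zspan0|exact: zspan_sub|].
by move=> c Sc; apply: zspan_gen; right.
Qed.

End GeneratedAlgebra.

(** * The quotient by the operadic ideal as an algebra *)

(* Finite support matters: the ideal spanned by the [word]s is closed under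
   multiplication by finite combinations of trees only. *)
Definition tdelta_span := zspan (fun f => exists t, f = tdelta t).
Definition tdelta_subgroup : subgroup (tree -> rat^o) :=
  Subgroup (zspan0 _ : tdelta_span 0) (@zspan_sub _ _).

Definition ftree : Type :=
  {f : tree -> rat^o | subgroup_pred tdelta_subgroup f}.
HB.instance Definition _ := SubChoice.on ftree.
HB.instance Definition _ := [SubChoice_isSubZmodule of ftree by <:].

Lemma ftree_span (f : ftree) : tdelta_span (val f).
Proof. by case: f => f /= /asboolP. Qed.

Lemma tmulBl o (f g h : tree -> rat^o) :
  tmul o (f - g) h = tmul o f h - tmul o g h.
Proof. by apply/eqP; rewrite eq_sym subr_eq -tmulDl subrK. Qed.
Lemma tmulBr o (f g h : tree -> rat^o) :
  tmul o h (f - g) = tmul o h f - tmul o h g.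
Proof. by apply/eqP; rewrite eq_sym subr_eq -tmulDr subrK. Qed.

Lemma tmul_span o f g :
  tdelta_span f -> tdelta_span g -> tdelta_span (tmul o f g).
Proof.
move=> Sf; move: g; apply: zspan_min => [|g h Sg Sh|_ [u ->]].
- by rewrite -[0](subrr f) tmulBr subrr; apply: zspan0.
- by rewrite tmulBr; apply: zspan_sub.
move: f Sf; apply: zspan_min => [|g h Sg Sh|_ [t ->]].
- by rewrite -[0](subrr (tdelta u)) tmulBl subrr; apply: zspan0.
- by rewrite tmulBl; apply: zspan_sub.
by rewrite tmul_delta; apply: zspan_gen; exists (Node o t u).
Qed.

Fact fmul_subproof o (f g : ftree) :
  subgroup_pred tdelta_subgroup (tmul o (val f) (val g)).
Proof. by apply/asboolP/tmul_span; apply: ftree_span. Qed.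

Definition fmul o (f g : ftree) : ftree := Sub _ (fmul_subproof o f g).

Lemma val_fmul o f g : val (fmul o f g) = tmul o (val f) (val g).
Proof. exact: SubK. Qed.

Lemma fmulDl o f g h : fmul o (f + g) h = fmul o f h + fmul o g h.
Proof. by apply: val_inj; rewrite val_fmul !raddfD /= tmulDl. Qed.
Lemma fmulDr o f g h : fmul o f (g + h) = fmul o f g + fmul o f h.
Proof. by apply: val_inj; rewrite val_fmul !raddfD /= tmulDr. Qed.

Lemma fmulBl o f g h : fmul o (f - g) h = fmul o f h - fmul o g h.
Proof. by apply/eqP; rewrite eq_sym subr_eq -fmulDl subrK. Qed.
Lemma fmulBr o f g h : fmul o f (g - h) = fmul o f g - fmul o f h.
Proof. by apply/eqP; rewrite eq_sym subr_eq -fmulDr subrK. Qed.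

Fact fdelta_subproof t : subgroup_pred tdelta_subgroup (tdelta t).
Proof. by apply/asboolP/zspan_gen; exists t. Qed.
Definition fdelta t : ftree := Sub _ (fdelta_subproof t).
Lemma val_fdelta t : val (fdelta t) = tdelta t. Proof. exact: SubK. Qed.

Lemma ev_fdelta t : ev fmul (fun=> fdelta Leaf) t = fdelta t.
Proof.
apply: val_inj; rewrite (@ev_morph _ _ fmul tmul val) ?val_fdelta ?ev_tdelta //.
Qed.

Lemma fdelta_span f : zspan (fun g => exists t, g = fdelta t) f.
Proof.
have [g Sg /val_inj <-] // :
    exists2 g, zspan (fun g => exists t, g = fdelta t) g & val g = val f.
apply: zspan_lift => [g h|]; first exact: raddfB.
have := ftree_span f; apply: zspan_min; [exact: zspan0|exact: zspan_sub|].
move=> _ [t ->]; apply: zspan_gen.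
by exists (fdelta t); [exists t|rewrite val_fdelta].
Qed.

Section QuotientByIdeal.
Let R : seq (freeop rat 3) := relations 1.

Fact ftideal0 : tideal R (val (0 : ftree)).
Proof. by move=> n; rewrite raddf0 -[0](subrr 0) arity_partB subrr mem0v. Qed.
Fact ftidealB (f g : ftree) :
  tideal R (val f) -> tideal R (val g) -> tideal R (val (f - g)).
Proof. by move=> fI gI n; rewrite raddfB arity_partB rpredB ?fI ?gI. Qed.
Definition ftideal : subgroup ftree :=
  @Subgroup _ (fun f : ftree => tideal R (val f)) ftideal0 ftidealB.

Lemma ftideal_mulr o (f g : ftree) : ftideal f -> ftideal (fmul o f g).
Proof.
move=> fI; have := fdelta_span g; move: g.
apply: zspan_min => [|g h gI hI|_ [t ->]].
- by rewrite -[0](subrr f) fmulBr subrr; apply: ftideal0.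
- by rewrite fmulBr; apply: ftidealB.
- exact: (@tideal_mulr R o (val f) t).
Qed.

Lemma ftideal_mull o (f g : ftree) : ftideal g -> ftideal (fmul o f g).
Proof.
move=> gI; have := fdelta_span f; move: f.
apply: zspan_min => [|f h fI hI|_ [t ->]].
- by rewrite -[0](subrr g) fmulBl subrr; apply: ftideal0.
- by rewrite fmulBl; apply: ftidealB.
- exact: (@tideal_mull R o t (val g)).
Qed.

(** Known for trees by [tideal_relation]; additivity in each argument extends it to finite
    combinations, one argument at a time. *)
Lemma ftideal_relations (f g h : ftree) r : r \in R ->
  tideal R (lin_tree (ev tmul (fun i => nth 0 [:: val f; val g; val h] i)) r).
Proof.
move=> rR.
pose P (u v w : tree -> rat^o) :=
  tideal R (lin_tree (ev tmul (fun i => nth 0 [:: u; v; w] i)) r).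
have Psub i c d rho : (i < 3)%N ->
    tideal R (lin_tree (ev tmul (subst_arg rho i 1 c)) r) ->
    tideal R (lin_tree (ev tmul (subst_arg rho i 1 d)) r) ->
    tideal R (lin_tree (ev tmul (subst_arg rho i 1 (c - d))) r).
  move=> i3 Ic Id n.
  suff -> : lin_tree (ev tmul (subst_arg rho i 1 (c - d))) r =
      lin_tree (ev tmul (subst_arg rho i 1 c)) r -
      lin_tree (ev tmul (subst_arg rho i 1 d)) r.
    by rewrite arity_partB rpredB ?Ic ?Id.
  rewrite /lin_tree -sumrB; apply: eq_bigr => t _; rewrite -scalerBr.
  congr (_ *: _).
  have it : (i < leaves (val t))%N by rewrite (eqP (valP t)).
  have lin := ev_subst_linear tmulDl tmulDr tmulZl tmulZr rho 1 _ _ _ it.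
  by rewrite [c - d]addrC -scaleN1r lin scaleN1r addrC.
have subst0 u v w : (fun i => nth 0 [:: u; v; w] i) =
    subst_arg (fun i => nth 0 [:: 0; v; w] i) 0 1 u.
  by apply/funext => -[|j]; rewrite /subst_arg //= addn1.
have subst1 u v w : (fun i => nth 0 [:: u; v; w] i) =
    subst_arg (fun i => nth 0 [:: u; 0; w] i) 1 1 v.
  by apply/funext => -[|[|j]]; rewrite /subst_arg //= addn1.
have subst2 u v w : (fun i => nth 0 [:: u; v; w] i) =
    subst_arg (fun i => nth 0 [:: u; v; 0] i) 2 1 w.
  by apply/funext => -[|[|[|j]]]; rewrite /subst_arg //= addn1.
have P_min (Q : (tree -> rat^o) -> Prop) (k : ftree) :
    (forall c d, Q c -> Q d -> Q (c - d)) -> (forall t, Q (tdelta t)) ->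
    Q (val k).
  move=> QB Qd; have := ftree_span k; apply: zspan_min => // [|_ [t ->]] //.
  by rewrite -[0](subrr (tdelta Leaf)); apply: QB.
apply: (P_min (fun u => P u (val g) (val h)) f) => [c d Pc Pd|u].
  by rewrite /P subst0; apply: Psub => //; rewrite -subst0.
apply: (P_min (fun v => P _ v (val h)) g) => [c d Pc Pd|v].
  by rewrite /P subst1; apply: Psub => //; rewrite -subst1.
apply: (P_min (fun w => P _ _ w) h) => [c d Pc Pd|w].
  by rewrite /P subst2; apply: Psub => //; rewrite -subst2.
exact: tideal_relation.
Qed.

(** Integer combinations of trees modulo those whose components lie in the rational ideal: a lattice
    in the free algebra on one generator. *)
Definition Xalg := zquot ftideal.
Definition Xmul : op -> Xalg -> Xalg -> Xalg := @zquot_mul _ ftideal fmul.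

Lemma Xmul_pi o f g :
  Xmul o (zpi ftideal f) (zpi ftideal g) = zpi ftideal (fmul o f g).
Proof. exact: (zquot_mulE fmulDl fmulDr ftideal_mulr ftideal_mull). Qed.

Lemma Xalg_laws : Xlaws Xmul.
Proof.
apply: (Xlaws_zquot fmulDl fmulDr ftideal_mulr ftideal_mull) => f g h.
apply: (@eq_from_nth _ 0) => // i; rewrite size_map => i16.
rewrite (nth_map 0) // nth_nseq if_same; apply/zpi_eq0 => /=.
have -> : val (nth 0 (Xdefects fmul f g h) i) =
    nth 0 (Xdefects tmul (val f) (val g) (val h)) i.
  by rewrite -(nth_map _ 0 val).
rewrite -(eval_relations tmul (fun i => nth 0 [:: val f; val g; val h] i)).
by rewrite (nth_map 0) //; apply: ftideal_relations; rewrite mem_nth.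
Qed.
End QuotientByIdeal.

(** * The dimension *)

(** D(a, a, a) = (a t a - a y a) y a, so a word is the difference of the combs starting with t and
    with y. *)
Definition comb (o : op) (w : seq op) : tree :=
  foldl (fun t o' => Node o' t Leaf) (Node opy (Node o Leaf Leaf) Leaf) w.

Lemma comb_rcons o w o' : comb o (rcons w o') = Node o' (comb o w) Leaf.
Proof. by rewrite /comb foldl_rcons. Qed.

Lemma leaves_comb o w : leaves (comb o w) = (3 + size w)%N.
Proof.
elim/last_ind: w => [//|w o' IHw].
by rewrite comb_rcons /= IHw size_rcons addn1.
Qed.

Lemma word_comb (A : zmodType) (m : op -> A -> A -> A) a w :
  (forall o b c d, m o (b - c) d = m o b d - m o c d) ->
  word m a w = ev m (fun=> a) (comb opt w) - ev m (fun=> a) (comb opy w).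
Proof.
move=> mB; elim/last_ind: w => [|w o IHw]; last first.
  by rewrite word_rcons IHw mB !comb_rcons.
by rewrite /word /= /defect /diff_ty mB.
Qed.

Section FixedArity.
Variable n : nat.
Hypothesis n5 : (5 <= n)%N.
Let I := gen_ideal (relations (1 : rat)) n.

Definition tvec (t : tree) : freeop rat n := arity_part n (tdelta t).

Lemma tvec_val (t : ntree n) : tvec (val t) = tree_vec rat t.
Proof. exact: arity_part_delta. Qed.

Lemma tvec_eq0 t : leaves t != n -> tvec t = 0.
Proof.
move=> tn; apply/ffunP => s; rewrite !ffunE /tdelta; case: eqP => // st.
by case/eqP: tn; rewrite -st (eqP (valP s)).
Qed.

Lemma lin_tvec (C : lmodType rat) (phi : tree -> C) t : leaves t = n ->
  lin_tree phi (tvec t) = phi t.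
Proof.
move=> /eqP tn; rewrite -[t]/(val (exist _ t tn : ntree n)) tvec_val.
exact: lin_tree_vec.
Qed.

(* The left comb x(..x(D(a,a,a),a)..,a). *)
Definition kappa : freeop rat n :=
  tvec (comb opt (nseq (n - 3) opx)) - tvec (comb opy (nseq (n - 3) opx)).

Definition spanning_vecs : seq (freeop rat n) :=
  kappa :: [seq tvec (nf p.1 p.2) | p <- nf_indices n].
Let W := <<spanning_vecs>>%VS.

Let fI (f : ftree) := arity_part n (val f).
Let fI_sub f g : fI (f - g) = fI f - fI g.
Proof. by rewrite /fI raddfB arity_partB. Qed.

Let ftideal_mem (f : ftree) : ftideal f -> fI f \in I.
Proof. by move=> fJ; apply: fJ. Qed.

Let a : Xalg := zpi ftideal (fdelta Leaf).

Let ev_Xmul t : ev Xmul (fun=> a) t = zpi ftideal (fdelta t).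
Proof.
rewrite -ev_fdelta (@ev_morph _ _ fmul Xmul (zpi ftideal)) // => o f g.
by rewrite Xmul_pi.
Qed.

Let fword w := fdelta (comb opt w) - fdelta (comb opy w).

Let zpi_fword w : zpi ftideal (fword w) = word Xmul a w.
Proof.
rewrite /fword zpiB -!ev_Xmul -word_comb // => o b c d.
by rewrite (XmulDl Xalg_laws) (XmulNl Xalg_laws).
Qed.

Let fI_word w : fI (fword w) \in (I + W)%VS.
Proof.
have fIE w' : fI (fword w') = tvec (comb opt w') - tvec (comb opy w').
  by rewrite fI_sub.
case: (eqVneq (3 + size w)%N n) => [wn|wn]; last first.
  by rewrite fIE !tvec_eq0 ?leaves_comb // subrr mem0v.
(* The full strength of n >= 5 is used here: a word of arity n has n - 3 factors after the defect,
   and [word_long] asks for two. *)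
have w2 : (2 <= size w)%N by lia.
have := word_long Xalg_laws a w2; case: ifP => _ wE; last first.
  apply: (subvP (addvSl _ _)); apply: ftideal_mem; apply/zpi_eq0.
  by rewrite zpi_fword wE.
rewrite -(subrK (fI (fword (nseq (size w) opx))) (fI _)) memv_add //.
  rewrite -fI_sub; apply: ftideal_mem; apply/zpi_eq.
  by rewrite !zpi_fword wE.
by rewrite fIE (_ : size w = n - 3)%N; [rewrite memv_span ?mem_head|lia].
Qed.

Let tree_mem (t : ntree n) : tree_vec rat t \in (I + W)%VS.
Proof.
have gen_span b : zspan (fun c => exists t, c = ev Xmul (fun=> a) t) b.
  rewrite -[b]zpi_repr; have := fdelta_span (repr b).
  apply: (zspan_map (@zpiB _ ftideal)) => _ [s ->]; apply: zspan_gen.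
  by exists s; rewrite ev_Xmul.
have [|f Sf fE] := @zspan_lift _ _ (zpi ftideal) (fun f =>
    (exists T i, [/\ bsize T = n, (i < n)%N & f = fdelta (nf T i)]) \/
    (exists w, f = fword w)) (zpi ftideal (fdelta (val t))) (@zpiB _ _).
  rewrite -ev_Xmul; have := gen_nf_word_span Xalg_laws gen_span (val t).
  rewrite (eqP (valP t)).
  apply: zspan_min; [exact: zspan0|exact: zspan_sub|].
  move=> _ [[T [i [Tn il ->]]]|[w ->]]; apply: zspan_gen.
    by exists (fdelta (nf T i)); [left; exists T, i|rewrite ev_Xmul].
  by exists (fword w); [right; exists w|rewrite zpi_fword].
have -> : tree_vec rat t = fI f - fI (f - fdelta (val t)).
  by rewrite fI_sub subKr -tvec_val.
apply: rpredB; last first.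
  by apply: (subvP (addvSl _ _)); apply: ftideal_mem; apply/zpi_eq.
move: f Sf {fE}; apply: zspan_min => [|f g fIW gIW|f].
- by rewrite -[0](subrr 0) fI_sub subrr mem0v.
- by rewrite fI_sub rpredB.
case=> [[T [i [Tn il ->]]]|[w ->]]; last exact: fI_word.
apply: (subvP (addvSr _ _)); apply: memv_span; rewrite inE; apply/orP; right.
by apply/mapP; exists (T, i) => //; apply/nf_indicesP.
Qed.

Lemma ideal_add_span : (I + W = fullv)%VS.
Proof.
apply/vspaceP => f; rewrite memvf.
have -> : f = \sum_t f t *: tree_vec rat t.
  apply/ffunP => s; rewrite sum_ffunE (bigD1 s) //= !ffunE eqxx.
  rewrite big1 => [|t ts]; first by rewrite addr0 [RHS]mulr1.
  by rewrite !ffunE eq_sym (negbTE ts) [LHS]mulr0.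
by apply: rpred_sum => t _; rewrite rpredZ ?tree_mem.
Qed.

(** Elements of [pointed] are functions of rational arguments, so coefficients are recovered from
    values at the natural numbers. *)
Lemma poly_eq0_nat (p : {poly rat}) : (forall k : nat, p.[k%:R] = 0) -> p = 0.
Proof.
move=> p0; apply: (@roots_geq_poly_eq0 _ _ [seq k%:R | k <- iota 0 (size p)]).
- by apply/allP => _ /mapP[k _ ->]; apply/eqP.
- rewrite map_inj_uniq ?iota_uniq // => i j /eqP.
  by rewrite Num.Theory.eqr_nat => /eqP.
- by rewrite size_map size_iota.
Qed.

Let N := size (nf_indices n).
Let idx (j : 'I_N) := nth (BLeaf, 0%N) (nf_indices n) j.

Let idxP j : bsize (idx j).1 = n /\ ((idx j).2 < n)%N.
Proof. by apply/nf_indicesP; rewrite -surjective_pairing mem_nth. Qed.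

Let leaves_idx j : leaves (nf (idx j).1 (idx j).2) = n.
Proof. by have [sz lt] := idxP j; rewrite leaves_nf sz //; lia. Qed.

Let relation_coef_nf c0 (c : 'I_N -> rat) :
  c0 *: kappa + \sum_j c j *: tvec (nf (idx j).1 (idx j).2) \in I ->
  forall j, c j = 0.
Proof.
move=> cI j0.
have L0 := eval_gen_ideal dd_mulDl dd_mulDr dd_mulZl dd_mulZr (fun=> dd_gen)
  dd_laws cI.
have kappa0 : lin_tree (ev dd_mul (fun=> dd_gen)) kappa = 0.
  rewrite /kappa raddfB /= !lin_tvec ?leaves_comb ?size_nseq; try lia.
  rewrite -word_comb => [|o b d e]; last first.
    by rewrite (XmulDl dd_laws) (XmulNl dd_laws).
  elim/last_ind: (nseq _ _) => [|w o IHw]; first exact: dd_defect0.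
  by rewrite word_rcons IHw (Xmul0l dd_laws).
move: L0; rewrite linearD /= linearZ /= kappa0 scaler0 add0r raddf_sum /=.
pose T0 := (idx j0).1.
(* The coefficient of [T0] in the evaluated relation at v = 1: the exponent of u alone determines
   the mark. *)
pose p : {poly rat} := \sum_j (c j * (T0 == (idx j).1)%:R) *: 'X^((idx j).2.+1).
move=> L0; have p0 : p = 0.
  apply: poly_eq0_nat => k; rewrite /p horner_sum.
  move: (congr1 (fun F : pointed => F k%:R 1 T0) L0).
  rewrite !fct_sumE => e; apply: etrans e; apply: eq_bigr => j _.
  have [Tn il] := idxP j.
  rewrite hornerZ hornerXn linearZ /= lin_tvec // dd_nf ?Tn //.
  rewrite !fctE /btdelta expr1n mulr1 -mulrA; congr (_ * _); exact: mulrC.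
have := congr1 (fun p : {poly rat} => p`_((idx j0).2.+1)) p0.
rewrite coef0 /p coef_sum (bigD1 j0) //= coefZ coefXn !eqxx !mulr1.
rewrite big1 ?addr0 // => j jj0; rewrite coefZ coefXn eqSS -mulrA -natrM mulnb.
suff /negbTE -> : ~~ ((T0 == (idx j).1) && ((idx j0).2 == (idx j).2)).
  by rewrite mulr0.
apply: contra jj0 => /andP[/eqP e1 /eqP e2]; apply/eqP/val_inj/eqP => /=.
rewrite -(nth_uniq (BLeaf, 0%N) _ _ (nf_indices_uniq n)) //.
rewrite -/(idx j) -/(idx j0) [idx j]surjective_pairing.
by rewrite [idx j0]surjective_pairing e2 -e1.
Qed.

Let relation_coef_kappa c0 : c0 *: kappa \in I -> c0 = 0.
Proof.
have xyZl o (k b d : rat^o) : xy_mul o (k *: b) d = k *: xy_mul o b d.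
  by rewrite /xy_mul; case: ifP => _; rewrite ?scaler0 // -[LHS]mulrA.
have xyZr o (k b d : rat^o) : xy_mul o b (k *: d) = k *: xy_mul o b d.
  by rewrite /xy_mul; case: ifP => _; rewrite ?scaler0 // [LHS]mulrCA.
move=> cI; have := eval_gen_ideal (XmulDl xy_laws) (XmulDr xy_laws) xyZl xyZr
  (fun=> 1) xy_laws cI.
rewrite linearZ /= /kappa raddfB /= !lin_tvec ?leaves_comb ?size_nseq; try lia.
rewrite -word_comb => [|o b d e]; last first.
  by rewrite (XmulDl xy_laws) (XmulNl xy_laws).
have -> k : word xy_mul 1 (nseq k opx) = -1.
  elim: k => [|k IHk]; first by rewrite [LHS]xy_defect !mulr1.
  by rewrite -addn1 nseqD cats1 word_rcons IHk [LHS]mulr1.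
by move=> /eqP; rewrite -[_ *: _]/(_ * _) mulrN1 oppr_eq0 => /eqP.
Qed.

(** Independence modulo [I], which gives at once that the vectors are free and that [I] meets [W]
    trivially. *)
Let relation_coef (k : 'I_(size spanning_vecs) -> rat) :
  \sum_i k i *: spanning_vecs`_i \in I -> forall i, k i = 0.
Proof.
have sz : size spanning_vecs = N.+1 by rewrite /= size_map.
pose k' (i : 'I_N.+1) := k (cast_ord (esym sz) i).
have -> : \sum_i k i *: spanning_vecs`_i =
    k' ord0 *: kappa +
    \sum_(j < N) k' (lift ord0 j) *: tvec (nf (idx j).1 (idx j).2).
  rewrite (reindex (cast_ord (esym sz))) /=; last first.
    by exists (cast_ord sz) => i _; rewrite ?cast_ordK ?cast_ordKV.
  rewrite big_ord_recl /=; congr (_ + _); apply: eq_bigr => j _.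
  by rewrite /= add0n (nth_map (BLeaf, 0%N)).
move=> kI; have k'0 := relation_coef_nf kI.
have kappaI : k' ord0 *: kappa \in I.
  by move: kI; rewrite big1 ?addr0 // => j _; rewrite k'0 scale0r.
have k'00 := relation_coef_kappa kappaI => i.
rewrite -[i](cast_ordK sz) -/(k' _).
case: (unliftP ord0 (cast_ord sz i)) => [j ->|-> //].
exact: k'0.
Qed.

(** [quotv] takes its coordinates from the complement, so this is the dimension of the quotient; [W]
    is another complement of [I], with a known basis. *)
Lemma dim_quotient_ideal : \dim (I^C)%VS = ('C(2 * n, n - 1) + 1)%N.
Proof.
have sum0 (k : 'I_(size spanning_vecs) -> rat) :
    (forall i, k i = 0) -> \sum_i k i *: spanning_vecs`_i = 0.
  by move=> k0; rewrite big1 // => i _; rewrite k0 scale0r.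
have frX : free (in_tuple spanning_vecs).
  by apply/freeP => k k0; apply: relation_coef; rewrite k0 mem0v.
have cap0 : (I :&: W = 0)%VS.
  apply/eqP; rewrite -subv0; apply/subvP => f /memv_capP[fI'].
  move=> /(coord_span (X := in_tuple spanning_vecs)) fE.
  suff -> : f = 0 by apply: mem0v.
  by rewrite fE; apply: sum0; apply: relation_coef; rewrite -fE.
have dimW : \dim W = size spanning_vecs by apply/eqP; apply: frX.
have := dimv_disjoint_sum cap0; rewrite ideal_add_span dimv_compl => ->.
by rewrite addKn dimW /= size_map size_nf_indices ?addn1 //; lia.
Qed.

End FixedArity.

Theorem theorem4p1 (n : nat) (hn : (5 <= n)%N) :
  \dim {: Xplus rat n} = ('C(2 * n, n - 1) + 1)%N.
Proof. by rewrite dimvf; apply: dim_quotient_ideal. Qed.
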